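(* Let $\mathcal{D}_A\subseteq SM(\mathbb{R})^2$ be a free quadrilateral. If $X\in SM_n(\mathbb{R})^2$ is a free extreme point of $\mathcal{D}_A$, then $n\le2$. As a consequence, $\mathcal{D}_A$ is the matrix convex hull of the set of Arveson extreme points of $\mathcal{D}_A$ which are elements of $\mathcal{D}_A(2)$; in notation, $$\mathcal{D}_A=\mathrm{co}^{\mathrm{mat}}\big((\partial^{\mathrm{Arv}}\mathcal{D}_A)(2)\big).$$
   Context: $SM_n(\mathbb{R})^g$ is the set of $g$-tuples of real symmetric $n\times n$ matrices, $SM(\mathbb{R})^g=\bigcup_nSM_n(\mathbb{R})^g$; for $K\subseteq SM(\mathbb{R})^g$, $K(n)=K\cap SM_n(\mathbb{R})^g$. Products $V^TXV$ and direct sums of tuples are coordinatewise. For $A\in SM_d(\mathbb{R})^g$, $\mathcal{D}_A=\{X\in SM(\mathbb{R})^g: I+\sum_{i=1}^gA_i\otimes X_i\succeq0\}$ is the free spectrahedron defined by $A$. A free spectrahedron $K\subseteq SM(\mathbb{R})^2$ is a free quadrilateral if $K(1)\subset\mathbb{R}^2$ is a bounded quadrilateral in the classical sense and there is a pair $C$ of $4\times4$ real diagonal matrices with $K=\mathcal{D}_C$. A matrix convex combination of tuples $X^i\in SM_{n_i}(\mathbb{R})^g$, $i=1,\dots,\ell$, is a finite sum $\sum_{i=1}^\ell V_i^TX^iV_i$ with $V_i\in M_{n_i\times n}(\mathbb{R})$ and $\sum_iV_i^TV_i=I_n$. The matrix convex hull $\mathrm{co}^{\mathrm{mat}}(K)$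 is the set of all matrix convex combinations of elements of $K$. Tuples $X,Y\in SM_n(\mathbb{R})^g$ are unitarily equivalent if $U^TXU=Y$ for some real orthogonal $U$. A tuple $X\in K(n)$ is a free extreme point of a matrix convex set $K$ if whenever $X=\sum_{i=1}^kV_i^TY^iV_i$ is a matrix convex combination ($\sum_iV_i^TV_i=I_n$) with $Y^i\in K(n_i)$ and $V_i\ne0$ for each $i$, then for all $i$ either $n_i=n$ and $X$ is unitarily equivalent to $Y^i$, or $n_i>n$ and there is a tuple $Z^i\in K$ such that $X\oplus Z^i$ is unitarily equivalent to $Y^i$. A tuple $X\in\mathcal{D}_A(n)$ is an Arveson extreme point of $\mathcal{D}_A$ if $\begin{pmatrix}X&\beta\\\beta^T&\gamma\end{pmatrix}\in\mathcal{D}_A$ (with $\beta\in M_{n\times m}(\mathbb{R})^g$, $\gamma\in SM_m(\mathbb{R})^g$, $m\ge1$) implies $\beta=0$; the set of these is the Arveson boundary $\partial^{\mathrm{Arv}}\mathcal{D}_A$. *)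

(* Defs.v *)
From mathcomp Require Import all_boot all_order all_algebra.
From mathcomp Require Import classical_sets reals mxtens.

Set Implicit Arguments.
Unset Strict Implicit.
Unset Printing Implicit Defensive.

Import Order.TTheory GRing.Theory Num.Theory.
Local Open Scope classical_set_scope.
Local Open Scope ring_scope.

Definition mxtuple (R : realType) (g n : nat) := 'I_g -> 'M[R]_n.

(* A subset K of SM(R)^g is represented by its levels K(n).  Size 0, which the
   mathematics does not mention, is allowed for uniformity: there is exactly
   one tuple of 0 x 0 matrices, it lies in every free spectrahedron and in
   every matrix convex hull (as the empty combination), and it can never occur
   among the Y^i of [free_extreme] because V_i <> 0. *)
Definition mxtuple_set (R : realType) (g : nat) :=
  forall n : nat, set (mxtuple R g n).

Definition symtuple (R : realType) (g n : nat) (X : mxtuple R g n) : Prop :=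
  forall j, (X j)^T = X j.

Definition psdmx (R : realType) (n : nat) (M : 'M[R]_n) : Prop :=
  M^T = M /\ forall v : 'cV[R]_n, 0 <= (v^T *m M *m v) 0 0.

(* The free spectrahedron D_A; [*t] is the Kronecker product. *)
Definition free_spec (R : realType) (g d : nat) (A : mxtuple R g d) :
    mxtuple_set R g :=
  fun n => [set X : mxtuple R g n |
    symtuple X /\ psdmx (1%:M + \sum_(j < g) A j *t X j)].

Definition is_free_spec (R : realType) (g : nat) (K : mxtuple_set R g) : Prop :=
  exists d (A : mxtuple R g d), symtuple A /\ K = free_spec A.

(* K(1) as a subset of R^g *)
Definition level1 (R : realType) (g : nat) (K : mxtuple_set R g) :
    set 'rV[R]_g :=
  [set x | K 1%N (fun j => (x 0 j)%:M)].

Definition convex_hull (R : realType) (g m : nat) (v : 'I_m -> 'rV[R]_g) :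
    set 'rV[R]_g :=
  [set x | exists t : 'I_m -> R,
    [/\ forall i, 0 <= t i, \sum_i t i = 1 & x = \sum_i t i *: v i]].

(* Bounded (convex) quadrilateral with vertices v 0, ..., v 3: none of the
   four points is in the convex hull of the other three.  Level 1 of a
   spectrahedron is convex, so non-convex quadrilaterals are irrelevant. *)
Definition quadrilateral (R : realType) (S : set 'rV[R]_2) : Prop :=
  exists v : 'I_4 -> 'rV[R]_2,
    (forall i : 'I_4, ~ convex_hull (v \o lift i) (v i)) /\ S = convex_hull v.

Definition free_quadrilateral (R : realType) (K : mxtuple_set R 2) : Prop :=
  [/\ is_free_spec K,
      quadrilateral (level1 K)
    & exists C : mxtuple R 2 4, (forall j, is_diag_mx (C j)) /\ K = free_spec C].

(* X = \sum_i V_i^T Y^i V_i is a matrix convex combination. *)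
Definition mxconv_comb (R : realType) (g n l : nat) (k : 'I_l -> nat)
    (Y : forall i, mxtuple R g (k i)) (V : forall i, 'M[R]_(k i, n))
    (X : mxtuple R g n) : Prop :=
  \sum_i (V i)^T *m V i = 1%:M
  /\ forall j, X j = \sum_i (V i)^T *m Y i j *m V i.

Definition comat (R : realType) (g : nat) (K : mxtuple_set R g) :
    mxtuple_set R g :=
  fun n => [set X : mxtuple R g n |
    exists l (k : 'I_l -> nat)
      (Y : forall i, mxtuple R g (k i)) (V : forall i, 'M[R]_(k i, n)),
      (forall i, K (k i) (Y i)) /\ mxconv_comb Y V X].

(* The sizes are separate arguments, constrained to be equal, so that X (+) Z
   of size n + m can be compared with Y of size n' without a cast. *)
Definition unitary_equiv (R : realType) (g n m : nat)
    (X : mxtuple R g n) (Y : mxtuple R g m) : Prop :=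
  n = m /\ exists U : 'M[R]_(n, m),
    [/\ U^T *m U = 1%:M, U *m U^T = 1%:M
      & forall j, U^T *m X j *m U = Y j].

Definition dsum (R : realType) (g n m : nat)
    (X : mxtuple R g n) (Z : mxtuple R g m) : mxtuple R g (n + m) :=
  fun j => block_mx (X j) 0 0 (Z j).

Definition free_extreme (R : realType) (g : nat) (K : mxtuple_set R g)
    (n : nat) (X : mxtuple R g n) : Prop :=
  K n X /\
  forall l (k : 'I_l -> nat)
    (Y : forall i, mxtuple R g (k i)) (V : forall i, 'M[R]_(k i, n)),
    (forall i, K (k i) (Y i)) -> (forall i, V i != 0) -> mxconv_comb Y V X ->
    forall i,
      (k i = n /\ unitary_equiv X (Y i))
      \/ ((n < k i)%N /\
          exists m (Z : mxtuple R g m), K m Z /\ unitary_equiv (dsum X Z) (Y i)).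

Definition arveson (R : realType) (g : nat) (K : mxtuple_set R g) :
    mxtuple_set R g :=
  fun n => [set X : mxtuple R g n | K n X /\
    forall m (beta : 'I_g -> 'M[R]_(n, m)) (gamma : mxtuple R g m),
      (0 < m)%N -> symtuple gamma ->
      K (n + m)%N
        (fun j => block_mx (X j) (beta j) (beta j)^T (gamma j)) ->
      forall j, beta j = 0].

(* K(n0), as a subset of SM(R)^g *)
Definition level (R : realType) (g : nat) (K : mxtuple_set R g) (n0 : nat) :
    mxtuple_set R g :=
  fun n => [set X : mxtuple R g n | n = n0 /\ K n X].

(* Main.v *)
(* The four affine functionals cutting out the quadrilateral satisfy, after
   cyclic labelling and positive rescaling, m0 + m2 = m1 + m3 =: q, so that the
   quadrilateral is a projective image of the square 0 <= m0, m1 <= q.  Dividing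
   by q turns a tuple X into a pair of positive contractions.  Since the two
   contractions are constrained independently, the pair is a classical convex
   combination of pairs of projections, and a pair of projections splits into
   blocks of size at most 2.  Pulled back by the projective map, a pair of
   2 x 2 projections gives an Arveson extreme point of size 2.  Hence every X is
   a matrix convex combination of Arveson points of size 2, which also bounds
   the size of a free extreme point. *)

Require Import Defs.
From mathcomp Require Import all_boot all_order all_algebra.
From mathcomp Require Import boolp classical_sets reals mxtens.
From mathcomp Require Import complex spectral ring lra.

Set Implicit Arguments.
Unset Strict Implicit.
Unset Printing Implicit Defensive.

Import Order.TTheory GRing.Theory Num.Theory.
Local Open Scope ring_scope.

(** * Spectral theorem and positive semidefinite matrices *)

(** A diagonal [C] gives four affine functionals without saying which vertices they meet, so the
    cyclic labelling must be recovered: each vertex lies on two sides, no side holds three vertices,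
    and a finite enumeration then yields a 4-cycle. Any four affine functionals on the plane are
    linearly dependent; evaluating the dependence at the vertices makes its signs alternate around
    the cycle. The obstacle is that a projective map does not preserve the identity: the constant
    coordinate 1 becomes a positive definite [H_0]. Decompositions are therefore carried out for
    triples of homogeneous coordinates, on which congruences act linearly, and the normalisation is
    restored at the very end with a Gram factor of the constant coordinate. Projections give Arveson
    points because the kernels of [Q] and [1 - Q] span the space, so a dilation has no freedom
    left. *)

Lemma mulTmx_eq0 (R : realType) m n (A : 'M[R]_(m, n)) : A^T *m A = 0 -> A = 0.
Proof.
move=> AA0; apply/matrixP => i j; rewrite mxE; apply/eqP.
have := congr1 (fun M : 'M_n => M j j) AA0; rewrite !mxE => /eqP.
rewrite psumr_eq0 => [/allP/(_ i)|k _]; last by rewrite mxE -expr2 sqr_ge0.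
by rewrite mem_index_enum mxE mulf_eq0 orbb; apply.
Qed.

Lemma gram_ge0 (R : realType) n (v : 'cV[R]_n) : 0 <= (v^T *m v) 0 0.
Proof. by rewrite mxE sumr_ge0 // => i _; rewrite mxE -expr2 sqr_ge0. Qed.

Lemma unit_cV_neq0 (R : realType) n (v : 'cV[R]_n) : v^T *m v = 1%:M -> v != 0.
Proof.
apply: contra_eq_neq => ->; rewrite mulmx0 eq_sym.
by apply/eqP => /matrixP/(_ 0 0)/eqP; rewrite !mxE oner_eq0.
Qed.

Lemma normalize_cV (R : realType) n (v : 'cV[R]_n) :
  v != 0 -> exists c, (c *: v)^T *m (c *: v) = 1%:M.
Proof.
move=> v0; pose s := (v^T *m v) 0 0.
have s0 : 0 <= s by exact: gram_ge0.
have sE : v^T *m v = s%:M by exact: mx11_scalar.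
have sn0 : s != 0.
  apply: contra_neq v0 => s00; apply: mulTmx_eq0.
  by rewrite sE s00 raddf0.
exists (Num.sqrt s)^-1.
rewrite -scalemxAr [(_ *: v)^T]linearZ -scalemxAl scalerA sE scale_scalar_mx.
by rewrite -invfM -expr2 sqr_sqrtr // mulVf.
Qed.

(** An eigenvector is taken over the complex numbers; once its eigenvalue is known to be real, the
    real or the imaginary part of the vector serves. *)
Lemma symmx_eigen (R : realType) n (K : 'M[R]_n.+1) : K^T = K ->
  exists (a : R) (v : 'cV_n.+1), v^T *m v = 1%:M /\ K *m v = a *: v.
Proof.
move=> Ksym; have [[x y] /eigenvalueP[z zK z0]] :=
  eigenvalue_closed (map_mx (real_complex R) K) (ltn0Sn n).
pose u := map_mx (@complex.Re R) z; pose w := map_mx (@complex.Im R) z.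
have ReS (s : seq 'I_n.+1) (F : 'I_n.+1 -> R[i]) :
    complex.Re (\sum_(i <- s) F i) = \sum_(i <- s) complex.Re (F i).
  by elim/big_rec2: _ => // i p [q1 q2] _ <-; case: (F i).
have ImS (s : seq 'I_n.+1) (F : 'I_n.+1 -> R[i]) :
    complex.Im (\sum_(i <- s) F i) = \sum_(i <- s) complex.Im (F i).
  by elim/big_rec2: _ => // i p [q1 q2] _ <-; case: (F i).
have uK : u *m K = x *: u - y *: w.
  apply/rowP => j; have := congr1 (fun M : 'rV_n.+1 => complex.Re (M 0 j)) zK.
  rewrite !mxE ReS; case: (z 0 j) => p q /= <-; apply: eq_bigr => i _.
  by rewrite !mxE; case: (z 0 i) => a b /=; rewrite mulr0 subr0.
have wK : w *m K = x *: w + y *: u.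
  apply/rowP => j; have := congr1 (fun M : 'rV_n.+1 => complex.Im (M 0 j)) zK.
  rewrite !mxE ImS; case: (z 0 j) => p q /= <-; apply: eq_bigr => i _.
  by rewrite !mxE; case: (z 0 i) => a b /=; rewrite mulr0 add0r.
have uw0 : (u != 0) || (w != 0).
  rewrite -negb_and; apply: contra_neqN z0 => /andP[/eqP u0 /eqP w0].
  apply/rowP => j; have := congr1 (fun M : 'rV_n.+1 => M 0 j) u0.
  have := congr1 (fun M : 'rV_n.+1 => M 0 j) w0; rewrite !mxE.
  by case: (z 0 j) => p q /= -> ->.
(* Expanding [u *m K *m w^T] on either side of [K] gives [y (|u|^2 + |w|^2) = 0]. *)
have y0 : y = 0.
  have : u *m (w *m K)^T = u *m K *m w^T by rewrite trmx_mul Ksym mulmxA.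
  rewrite uK wK mulmxBl linearD !linearZ /= mulmxDr -!scalemxAl -!scalemxAr.
  move=> /eqP; rewrite -subr_eq0 opprB addrC addrA subrK.
  rewrite -scalerDr scaler_eq0 => /orP[/eqP//|].
  have nn (t : 'rV[R]_n.+1) : 0 <= (t *m t^T) 0 0.
    by have := gram_ge0 t^T; rewrite trmxK.
  have t0 (t : 'rV[R]_n.+1) : (t *m t^T) 0 0 = 0 -> t = 0.
    move=> tt0; apply: trmx_inj; rewrite trmx0; apply: mulTmx_eq0.
    by rewrite trmxK [LHS]mx11_scalar tt0 raddf0.
  move/eqP/matrixP/(_ 0 0); rewrite mxE [in RHS]mxE => /eqP.
  rewrite paddr_eq0 ?nn // => /andP[/eqP/t0 w0 /eqP/t0 u0].
  by move: uw0; rewrite w0 u0 eqxx.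
move: uK wK; rewrite y0 !scale0r subr0 addr0 => uK wK.
have [t t0 tK] : exists2 t : 'rV_n.+1, t != 0 & t *m K = x *: t.
  by case/orP: uw0; [exists u | exists w].
have tT0 : t^T != 0 by rewrite trmx_eq0.
have [c cE] := normalize_cV tT0; exists x, (c *: t^T); split=> //.
by rewrite -scalemxAr -{1}Ksym -trmx_mul tK linearZ /= !scalerA mulrC.
Qed.

(** Unless [v] is already the first basis vector [e], the Householder reflection in [v - e]
    exchanges the two; [s] is the squared norm of [v - e]. *)
Lemma orthogonal_completion (R : realType) n (v : 'cV[R]_n.+1) :
  v^T *m v = 1%:M ->
  exists U : 'M_n.+1, U^T *m U = 1%:M /\ U *m delta_mx 0 0 = v.
Proof.
move=> v1; pose e : 'cV[R]_n.+1 := delta_mx 0 0.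
have eT : e^T = delta_mx 0 0 :> 'rV_n.+1 by rewrite /e trmx_delta.
have ee : e^T *m e = 1%:M.
  by rewrite eT /e mul_delta_mx; apply/matrixP => i j; rewrite !ord1 !mxE.
have ev : e^T *m v = (v 0 0)%:M.
  by rewrite eT -rowE; apply/matrixP => i j; rewrite !ord1 !mxE.
have ve : v^T *m e = (v 0 0)%:M.
  by rewrite -[LHS]trmxK trmx_mul trmxK ev tr_scalar_mx.
have [ve0|vne] := eqVneq v e.
  by exists 1%:M; rewrite trmx1 !mul1mx ve0.
pose w := v - e; pose s := 2 - 2 * v 0 0.
have wT : w^T = v^T - e^T by rewrite /w linearB.
have ww : w^T *m w = s%:M.
  rewrite wT mulmxBl !mulmxBr v1 ve ev ee -!raddfB; congr _%:M.
  by rewrite /s; ring.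
have s0 : s != 0.
  apply: contra_neq vne => s0; apply/subr0_eq/mulTmx_eq0.
  by rewrite -/w ww s0 raddf0.
have Us : (1%:M - (2 / s) *: (w *m w^T))^T = 1%:M - (2 / s) *: (w *m w^T).
  by rewrite linearB linearZ /= trmx1 trmx_mul trmxK.
exists (1%:M - (2 / s) *: (w *m w^T)); split.
  rewrite Us mulmxBl mul1mx mulmxBr mulmx1 -scalemxAl -scalemxAr.
  rewrite mulmxA -(mulmxA w) ww mul_mx_scalar -scalemxAl !scalerA.
  rewrite -scalerBl -addrA -opprD -scalerDl.
  rewrite [X in X *: _](_ : _ = 0) ?scale0r ?subr0 //; by field.
rewrite -/e mulmxBl mul1mx -scalemxAl -mulmxA wT (mulmxBl v^T) ve ee -raddfB.
rewrite mul_mx_scalar scalerA.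
suff -> : 2 / s * (v 0 0 - 1) = -1 by rewrite scaleN1r opprK /w addrC subrK.
by move: s0; rewrite /s => ?; field.
Qed.

Lemma symmx_spectral (R : realType) n (K : 'M[R]_n) : K^T = K ->
  exists (U : 'M_n) (d : 'rV_n),
    U^T *m U = 1%:M /\ K = U^T *m diag_mx d *m U.
Proof.
elim: n K => [|n IHn] K Ksym.
  by exists 1%:M, 0; split; apply/matrixP => -[].
have [a [v [v1 Kv]]] := symmx_eigen Ksym.
have [U0 [U01 U0e]] := orthogonal_completion v1.
(* In a basis starting with the eigenvector, the first column of [K1], and by symmetry its first
   row, is zero off the diagonal; induction treats the remaining block. *)
pose K1 : 'M_(1 + n) := U0^T *m K *m U0.
have K1sym : K1^T = K1 by rewrite /K1 !trmx_mul trmxK Ksym mulmxA.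
have K1e : col 0 K1 = a *: delta_mx 0 0.
  rewrite colE /K1 -!mulmxA U0e Kv -scalemxAr -U0e mulmxA U01 mul1mx //.
have K10 i : K1 i 0 = a *+ (i == 0).
  have /matrixP/(_ i 0) := K1e; rewrite !mxE andbT => ->.
  by rewrite mulr_natr.
have U0T : U0 *m U0^T = 1%:M by exact: mulmx1C.
have KE : K = U0 *m K1 *m U0^T.
  by rewrite /K1 !mulmxA U0T mul1mx -mulmxA U0T mulmx1.
clearbody K1.
have [|V [d [V1 K2E]]] := IHn (drsubmx K1).
  by rewrite trmx_drsub K1sym.
have l0 : lshift n (0 : 'I_1) = 0 :> 'I_n.+1 by exact: val_inj.
have K1E : K1 = block_mx a%:M 0 0 (drsubmx K1).
  rewrite -[LHS]submxK; congr block_mx.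
  - apply/matrixP => i j; rewrite !ord1 !mxE.
    by rewrite l0 K10.
  - rewrite -{1}K1sym; apply/matrixP => i j; rewrite !ord1 !mxE.
    by rewrite l0 K10.
  - apply/matrixP => i j; rewrite !ord1 !mxE.
    by rewrite l0 K10.
pose V' : 'M_(1 + n) := block_mx 1%:M 0 0 V.
have V'T : V'^T = block_mx 1%:M 0 0 V^T.
  by rewrite tr_block_mx trmx1 !trmx0.
have V'1 : V'^T *m V' = 1%:M.
  rewrite V'T mulmx_block !mulmx0 !mul0mx !addr0 !add0r mulmx1 V1.
  by rewrite -scalar_mx_block.
have K1D : K1 = V'^T *m diag_mx (row_mx a%:M d) *m V'.
  rewrite V'T diag_mx_row !mulmx_block !mulmx0 !mul0mx !addr0 !add0r.
  rewrite !mul1mx !mulmx1 K1E K2E; congr block_mx; rewrite ?mul0mx //.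
  by apply/matrixP => i j; rewrite !ord1 !mxE.
exists (V' *m U0^T), (row_mx a%:M d); split.
  by rewrite trmx_mul trmxK mulmxA -(mulmxA U0) V'1 mulmx1.
by rewrite KE K1D trmx_mul trmxK !mulmxA.
Qed.

Lemma psdmx_congr (R : realType) m n (M : 'M[R]_m) (V : 'M_(m, n)) :
  psdmx M -> psdmx (V^T *m M *m V).
Proof.
case=> Msym M0; split; first by rewrite !trmx_mul trmxK Msym mulmxA.
by move=> v; have := M0 (V *m v); rewrite trmx_mul !mulmxA.
Qed.

Lemma psdmxD (R : realType) n (M N : 'M[R]_n) :
  psdmx M -> psdmx N -> psdmx (M + N).
Proof.
case=> Ms M0 [Ns N0]; split=> [|v]; first by rewrite linearD /= Ms Ns.
by rewrite mulmxDr mulmxDl mxE addr_ge0.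
Qed.

Lemma psdmx0 (R : realType) n : psdmx (0 : 'M[R]_n).
Proof. by split=> [|v]; rewrite ?trmx0 // mulmx0 mul0mx mxE. Qed.

Lemma psdmx_sum (R : realType) n (I : Type) (s : seq I) (F : I -> 'M[R]_n) :
  (forall i, psdmx (F i)) -> psdmx (\sum_(i <- s) F i).
Proof. by move=> F0; elim/big_ind: _ => //; [exact: psdmx0|exact: psdmxD]. Qed.

Lemma psdmxZ (R : realType) n (c : R) (M : 'M[R]_n) :
  0 <= c -> psdmx M -> psdmx (c *: M).
Proof.
move=> c0 [Ms M0]; split=> [|v]; first by rewrite linearZ /= Ms.
by rewrite -scalemxAr -scalemxAl mxE mulr_ge0.
Qed.

Lemma psdmx_gram (R : realType) m n (S : 'M[R]_(m, n)) : psdmx (S^T *m S).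
Proof.
split=> [|v]; first by rewrite trmx_mul trmxK.
rewrite mulmxA -trmx_mul -mulmxA mxE sumr_ge0 // => i _.
by rewrite mxE -expr2 sqr_ge0.
Qed.

Lemma psdmx_proj (R : realType) n (Q : 'M[R]_n) :
  Q^T = Q -> Q *m Q = Q -> psdmx Q.
Proof. by move=> Qs QQ; rewrite -QQ -{1}Qs; exact: psdmx_gram. Qed.

Lemma compl_proj (R : realType) n (Q : 'M[R]_n) :
  Q *m Q = Q -> (1%:M - Q) *m (1%:M - Q) = 1%:M - Q.
Proof. by move=> QQ; rewrite mulmxBl mul1mx mulmxBr mulmx1 QQ subrr subr0. Qed.

Lemma psdmx_diag_ge0 (R : realType) n (d : 'rV[R]_n) :
  psdmx (diag_mx d) -> forall i, 0 <= d 0 i.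
Proof.
case=> _ d0 i; have := d0 (delta_mx i 0).
rewrite trmx_delta -rowE -colE !mxE.
by rewrite eqxx mulr1n.
Qed.

Lemma psdmx_sqrt (R : realType) n (K : 'M[R]_n) :
  psdmx K -> exists S : 'M_n, K = S^T *m S.
Proof.
move=> Kpsd; have [U [d [U1 KE]]] := symmx_spectral Kpsd.1.
have U2 : U *m U^T = 1%:M by exact: mulmx1C.
have d0 : forall i, 0 <= d 0 i.
  apply: psdmx_diag_ge0; have := psdmx_congr U^T Kpsd.
  by rewrite trmxK KE !mulmxA U2 mul1mx -mulmxA U2 mulmx1.
exists (diag_mx (map_mx Num.sqrt d) *m U).
rewrite trmx_mul tr_diag_mx KE !mulmxA; congr (_ *m _).
rewrite -mulmxA; congr (_ *m _); apply/matrixP => i j.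
rewrite mul_diag_mx !mxE; have [->|] := eqVneq i j; last by rewrite !mulr0n mulr0.
by rewrite !mulr1n -expr2 sqr_sqrtr.
Qed.

Lemma psdmx_ker (R : realType) n m (K : 'M[R]_n) (V : 'M_(n, m)) :
  psdmx K -> V^T *m K *m V = 0 -> K *m V = 0.
Proof.
case/psdmx_sqrt=> S ->; rewrite mulmxA -trmx_mul -mulmxA => /mulTmx_eq0 SV.
by rewrite -mulmxA SV mulmx0.
Qed.

Definition pdmx (R : realType) n (K : 'M[R]_n) :=
  psdmx K /\ forall v : 'cV_n, v^T *m K *m v = 0 -> v = 0.

Lemma pdmx_sqrt (R : realType) n (K : 'M[R]_n) :
  pdmx K -> exists2 S : 'M_n, K = S^T *m S & S \in unitmx.
Proof.
case=> /psdmx_sqrt[S ->] Kpos; exists S => //.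
rewrite -unitmx_tr -row_free_unit -kermx_eq0; apply/eqP/row_matrixP => i.
rewrite row0; apply: trmx_inj; rewrite trmx0; apply: Kpos.
rewrite mulmxA trmxK -row_mul mulmx_ker row0 !mul0mx //.
Qed.

(** Columns on which the form of the corner [P] vanishes, extended by 0, lie in the kernel of the
    whole block matrix. This is how positivity of a dilation constrains its off-diagonal block. *)
Lemma psdmx_block_ker (R : realType) n m p (P : 'M[R]_n) (B : 'M_(n, m))
    (G : 'M_m) (V : 'M_(n, p)) :
  psdmx (block_mx P B B^T G) -> V^T *m P *m V = 0 -> V^T *m B = 0.
Proof.
move=> Mpsd PV; have := @psdmx_ker _ _ _ _ (col_mx V 0) Mpsd.
rewrite tr_col_mx mul_row_block mul_row_col trmx0 !mul0mx !addr0 ?mulmx0 ?addr0.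
move=> /(_ PV)/(congr1 dsubmx); rewrite mul_block_col !mulmx0 !addr0 col_mxKd.
rewrite linear0 => BV; apply: trmx_inj.
by rewrite trmx_mul trmxK BV trmx0.
Qed.

(* A diagonal contraction is an iterated average of 0/1 diagonal matrices. *)
Lemma contraction_ind (R : realType) n (G : 'M[R]_n -> Prop) :
  (forall t A B, 0 <= t <= 1 -> G A -> G B -> G ((1 - t) *: A + t *: B)) ->
  (forall Q, Q^T = Q -> Q *m Q = Q -> G Q) ->
  forall P, psdmx P -> psdmx (1%:M - P) -> G P.
Proof.
move=> Gconv Gproj P P0 P1; have [U [d [U1 PE]]] := symmx_spectral P0.1.
have U2 : U *m U^T = 1%:M by exact: mulmx1C.
have {P0}d0 : forall i, 0 <= d 0 i.
  apply: psdmx_diag_ge0; have := psdmx_congr U^T P0.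
  by rewrite trmxK PE !mulmxA U2 mul1mx -mulmxA U2 mulmx1.
have {P1}d1 i : d 0 i <= 1.
  have : 0 <= (const_mx 1 - d) 0 i.
    apply: psdmx_diag_ge0; have := psdmx_congr U^T P1.
    rewrite trmxK PE mulmxBr mulmxBl mulmx1 U2 !mulmxA U2 mul1mx -mulmxA U2.
    by rewrite mulmx1 raddfB /= diag_const_mx.
  by rewrite !mxE subr_ge0.
rewrite {P}PE.
(* Induction on the number of eigenvalues different from 0 and 1; with none left the matrix is a
   projection. *)
have [N] := ubnP #|[pred i | (d 0 i != 0) && (d 0 i != 1)]|.
elim: N d d0 d1 => // N IHN d d0 d1; rewrite ltnS => cN.
case: (pickP [pred i | (d 0 i != 0) && (d 0 i != 1)]) => [i /= iP|noi]; last first.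
  apply: Gproj; first by rewrite !trmx_mul trmxK tr_diag_mx mulmxA.
  rewrite !mulmxA; congr (_ *m _); rewrite -!mulmxA; congr (_ *m _).
  rewrite !mulmxA -(mulmxA _ U) U2 mulmx1; apply/matrixP => j k.
  rewrite mul_diag_mx !mxE; have [->|_] := eqVneq j k; last by rewrite !mulr0n mulr0.
  rewrite !mulr1n; have /negbT := noi k; rewrite /= negb_and !negbK.
  by case/orP=> /eqP ->; rewrite ?mulr0 ?mulr1.
(* Moving the entry [i] to 0 or to 1 gives two matrices whose average, with weights [1 - d 0 i] and
   [d 0 i], is the original one. *)
pose e (c : R) := \row_j (if j == i then c else d 0 j).
have -> : U^T *m diag_mx d *m U =
    (1 - d 0 i) *: (U^T *m diag_mx (e 0) *m U) +
    d 0 i *: (U^T *m diag_mx (e 1) *m U).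
  rewrite !(scalemxAl _ _ U) !scalemxAr -mulmxDl -mulmxDr; congr (_ *m _ *m _).
  rewrite -!linearZ -linearD; congr diag_mx; apply/rowP => j; rewrite !mxE.
  case: eqP => [->|_]; first by rewrite mulr0 add0r mulr1.
  by ring.
have step c : c \in [:: 0; 1] -> G (U^T *m diag_mx (e c) *m U).
  move=> c01; have /andP[c0 c1] : 0 <= c <= 1.
    by move: c01; rewrite !inE => /orP[] /eqP ->; rewrite lexx ler01.
  apply: IHN => [j|j|]; rewrite ?mxE; try by case: ifP.
  apply: leq_trans cN; apply: proper_card; apply/properP; split.
    apply/fintype.subsetP => j; rewrite !inE !mxE; have [_|//] := eqVneq j i.
    by move: c01; rewrite !inE => /orP[] /eqP ->; rewrite eqxx ?andbF.
  exists i => //; rewrite !inE !mxE eqxx.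
  by move: c01; rewrite !inE => /orP[] /eqP ->; rewrite eqxx ?andbF.
apply: Gconv; first by rewrite d0 d1.
  by apply: step; rewrite inE eqxx.
by apply: step; rewrite !inE eqxx orbT.
Qed.

(** * Pairs of projections *)

Definition is_proj (R : realType) n (Q : 'M[R]_n) := Q^T = Q /\ Q *m Q = Q.

(** One list serves all three sums, and [H] need not be the identity: this makes the notion stable
    under sums, nonnegative multiples and congruences, and lets [H] be the constant coordinate of a
    projective image. *)
Definition proj_dec (R : realType) n (H A B : 'M[R]_n) : Prop :=
  exists s : seq ('M[R]_(2, n) * ('M[R]_2 * 'M[R]_2)),
    (forall x, x \in s -> is_proj x.2.1 /\ is_proj x.2.2) /\
    [/\ H = \sum_(x <- s) x.1^T *m x.1,
        A = \sum_(x <- s) x.1^T *m x.2.1 *m x.1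
      & B = \sum_(x <- s) x.1^T *m x.2.2 *m x.1].

Lemma proj_dec0 (R : realType) n : proj_dec (0 : 'M[R]_n) 0 0.
Proof. by exists [::]; split=> //; rewrite !big_nil. Qed.

Lemma proj_dec1 (R : realType) n (W : 'M[R]_(2, n)) (Q1 Q2 : 'M_2) :
  is_proj Q1 -> is_proj Q2 ->
  proj_dec (W^T *m W) (W^T *m Q1 *m W) (W^T *m Q2 *m W).
Proof.
move=> P1 P2; exists [:: (W, (Q1, Q2))]; split=> [x|].
  by rewrite inE => /eqP ->.
by rewrite !big_seq1.
Qed.

Lemma proj_decD (R : realType) n (H A B H' A' B' : 'M[R]_n) :
  proj_dec H A B -> proj_dec H' A' B' -> proj_dec (H + H') (A + A') (B + B').
Proof.
move=> [s [sP [-> -> ->]]] [s' [sP' [-> -> ->]]]; exists (s ++ s').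
split=> [x|]; last by rewrite !big_cat.
by rewrite mem_cat => /orP[/sP|/sP'].
Qed.

Lemma proj_dec_congr (R : realType) n m (H A B : 'M[R]_n) (V : 'M_(n, m)) :
  proj_dec H A B ->
  proj_dec (V^T *m H *m V) (V^T *m A *m V) (V^T *m B *m V).
Proof.
move=> [s [sP [-> -> ->]]]; exists [seq (x.1 *m V, x.2) | x <- s].
split=> [_ /mapP[x xs ->]|]; first exact: sP.
rewrite !big_map !mulmx_sumr !mulmx_suml.
by split; apply: eq_bigr => x _; rewrite /= trmx_mul !mulmxA.
Qed.

Lemma proj_decZ (R : realType) n (c : R) (H A B : 'M[R]_n) :
  0 <= c -> proj_dec H A B -> proj_dec (c *: H) (c *: A) (c *: B).
Proof.
move=> c0 /(@proj_dec_congr _ _ _ _ _ _ (Num.sqrt c)%:M).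
by rewrite tr_scalar_mx !mul_scalar_mx !mul_mx_scalar !scalerA -expr2 sqr_sqrtr.
Qed.

(** With [M = W^T *m W] idempotent, the Gram matrix of [W - W *m M] expands to 0, so [W] is a
    partial isometry. *)
Lemma gram_proj_id (R : realType) m n (W : 'M[R]_(m, n)) :
  W^T *m W *m (W^T *m W) = W^T *m W -> W *m (W^T *m W) = W.
Proof.
set M := W^T *m W => MM; have Ms : M^T = M by rewrite /M trmx_mul trmxK.
apply/eqP; rewrite eq_sym -subr_eq0; apply/eqP/mulTmx_eq0.
rewrite [(W - _)^T]linearB /= trmx_mul Ms mulmxBl !mulmxBr -/M -!mulmxA.
by rewrite !(mulmxA W^T) -/M !MM !subrr.
Qed.

Lemma gram2 (R : realType) n (a b : 'cV[R]_n) :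
  exists W : 'M_(2, n), W^T *m W = a *m a^T + b *m b^T.
Proof.
exists (col_mx a^T b^T : 'M_(1 + 1, n)).
by rewrite [_^T](@tr_col_mx _ 1 1) (@mul_row_col _ _ 1 1) !trmxK.
Qed.

(* Two projections [Q1], [Q2] commuting with [P] leave a subspace of dimension
   1 or 2 of the range of [P] invariant: if [Q1 v = v] and [Q1 Q2 v = mu v],
   then [w = Q2 v - mu v] is orthogonal to [v], is killed by [Q1], and
   [Q2] preserves the span of [v] and [w]. *)
Lemma two_proj_invariant (R : realType) n (Q1 Q2 P : 'M[R]_n) :
  is_proj Q1 -> is_proj Q2 -> is_proj P ->
  P *m Q1 = Q1 *m P -> P *m Q2 = Q2 *m P -> P != 0 ->
  exists W : 'M_(2, n), let M := W^T *m W in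
    [/\ M != 0, M *m M = M, P *m M = M,
        M *m Q1 *m M = Q1 *m M & M *m Q2 *m M = Q2 *m M].
Proof.
move=> [s1 i1] [s2 i2] [sP iP] c1 c2 P0.
have nzcol (K : 'M[R]_n) : K != 0 -> exists u : 'cV_n, K *m u != 0.
  move=> K0; case: (pickP (fun j => col j K != 0)) => [j jP|cz].
    by exists (delta_mx j 0); rewrite -colE.
  move: K0; rewrite (_ : K = 0) ?eqxx //; apply/matrixP => i j.
  have /negbFE/eqP/matrixP/(_ i 0) := cz j; by rewrite !mxE.
(* The one-dimensional case: a common eigenvector of [Q1] and [Q2] in the range of [P]. *)
have line (v : 'cV[R]_n) l1 l2 : v != 0 -> P *m v = v -> Q1 *m v = l1 *: v ->
    Q2 *m v = l2 *: v -> exists W : 'M_(2, n), let M := W^T *m W in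
    [/\ M != 0, M *m M = M, P *m M = M,
        M *m Q1 *m M = Q1 *m M & M *m Q2 *m M = Q2 *m M].
  move=> v0 Pv Q1v Q2v; have [c] := normalize_cV v0.
  have {v0 Pv Q1v Q2v} : [/\ P *m (c *: v) = c *: v,
      Q1 *m (c *: v) = l1 *: (c *: v) & Q2 *m (c *: v) = l2 *: (c *: v)].
    by rewrite -!scalemxAr Pv Q1v Q2v !scalerA !(mulrC c).
  move: (c *: v) => {}v [Pv Q1v Q2v] vv.
  have vvv : v *m v^T *m v = v by rewrite -mulmxA vv mulmx1.
  (* A line is padded with a zero row, so that every piece has size exactly 2. *)
  have [W WE] := gram2 v 0; exists W; rewrite /= WE mul0mx addr0; split.
  - apply: contra_eq_neq vvv => ->; rewrite mul0mx eq_sym.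
    exact: unit_cV_neq0.
  - by rewrite mulmxA vvv.
  - by rewrite mulmxA Pv.
  - by rewrite -mulmxA (mulmxA Q1) Q1v -scalemxAl -scalemxAr mulmxA vvv.
  - by rewrite -mulmxA (mulmxA Q2) Q2v -scalemxAl -scalemxAr mulmxA vvv.
(* If [Q1] vanishes on the range of [P], any eigenvector of [Q2] there will do: [P *m u] if [Q2]
   kills it, and [Q2 *m (P *m u)] otherwise. *)
have [E0|E0] := eqVneq (P *m Q1) 0.
  have [u u0] := nzcol _ P0.
  have [Q2u|Q2u] := eqVneq (Q2 *m (P *m u)) 0.
    apply: (line (P *m u) 0 0) => //; rewrite ?scale0r //.
      by rewrite mulmxA iP.
    by rewrite mulmxA -c1 E0 mul0mx.
  apply: (line (Q2 *m (P *m u)) 0 1) => //; rewrite ?scale0r ?scale1r //.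
  - by rewrite (mulmxA P) c2 -(mulmxA Q2) (mulmxA P) iP.
  - by rewrite (mulmxA Q2) -c2 -(mulmxA P) (mulmxA Q1) -c1 E0 mul0mx.
  - by rewrite mulmxA i2.
(* [E] is the projection onto the intersection of the ranges of [P] and [Q1]. *)
set E := P *m Q1 in E0; have sE : E^T = E by rewrite trmx_mul sP s1 -c1.
have PE : P *m E = E by rewrite mulmxA iP.
have Q1E : Q1 *m E = E by rewrite /E c1 mulmxA i1.
have iE : E *m E = E by rewrite {1}/E -mulmxA Q1E PE.
have EQ2 : E *m Q2 = Q1 *m Q2 *m P by rewrite /E c1 -!mulmxA c2.
clearbody E.
have [K0|K0] := eqVneq (E *m Q2 *m E) 0.
  have Q2E : Q2 *m E = 0.
    by apply: mulTmx_eq0; rewrite trmx_mul sE s2 mulmxA -(mulmxA E) i2.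
  have [u u0] := nzcol _ E0.
  apply: (line (E *m u) 1 0) => //; rewrite ?scale1r ?scale0r mulmxA.
  - by rewrite PE.
  - by rewrite Q1E.
  - by rewrite Q2E mul0mx.
(* A nonzero eigenvalue is required because it puts [v] in the range of [E], hence in those of [P]
   and [Q1]. *)
have [mu [v [mu0 v1 Kv]]] : exists (mu : R) (v : 'cV_n), [/\ mu != 0, v^T *m v = 1%:M &
    E *m Q2 *m E *m v = mu *: v].
  have [|U [d [U1 KE]]] := @symmx_spectral R n (E *m Q2 *m E).
    by rewrite !trmx_mul sE s2 mulmxA.
  have U2 : U *m U^T = 1%:M by exact: mulmx1C.
  case: (pickP (fun j => d 0 j != 0)) => [j jP|dz]; last first.
    move: K0; rewrite KE (_ : d = 0) ?raddf0 ?mulmx0 ?mul0mx ?eqxx //.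
    apply/rowP => j; rewrite mxE; exact/eqP/negbFE/dz.
  exists (d 0 j), (U^T *m delta_mx j 0); split=> //.
    rewrite trmx_mul trmxK mulmxA -(mulmxA _ U) U2 mulmx1 trmx_delta.
    by rewrite mul_delta_mx; apply/matrixP => a b; rewrite !ord1 !mxE.
  rewrite KE mulmxA -(mulmxA _ U) U2 mulmx1 -mulmxA scalemxAr; congr (_ *m _).
  apply/matrixP => a b; rewrite mul_diag_mx !mxE.
  by have [->|] := eqVneq a j => //=; rewrite !mulr0.
have Ev : E *m v = v.
  by apply: (scalerI mu0); rewrite scalemxAr -Kv !mulmxA iE //.
have EQv : E *m (Q2 *m v) = mu *: v by rewrite -{1}Ev !mulmxA.
have Pv : P *m v = v by rewrite -Ev mulmxA PE.
have Q1v : Q1 *m v = v by rewrite -Ev mulmxA Q1E.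
have Q1Q2v : Q1 *m (Q2 *m v) = mu *: v.
  by rewrite -EQv (mulmxA E) EQ2 -!mulmxA Pv.
pose w := Q2 *m v - mu *: v.
have Q2v : Q2 *m v = w + mu *: v by rewrite subrK.
have [w0|w0] := eqVneq w 0.
  apply: (line v 1 mu) => //; rewrite ?scale1r ?unit_cV_neq0 //.
  by rewrite Q2v w0 add0r.
have Q1w : Q1 *m w = 0 by rewrite mulmxBr Q1Q2v -scalemxAr Q1v subrr.
have Q2w : Q2 *m w = (1 - mu) *: (w + mu *: v).
  by rewrite {1}/w mulmxBr mulmxA i2 -scalemxAr Q2v scalerBl scale1r.
have Pw : P *m w = w.
  by rewrite mulmxBr mulmxA c2 -mulmxA -scalemxAr Pv.
have vw : v^T *m w = 0.
  by rewrite -{1}Q1v trmx_mul s1 -mulmxA Q1w mulmx0.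
clearbody w; have [c cE] := normalize_cV w0.
have {w0 Q1w Pw vw} [Q1w Pw vw] : [/\ Q1 *m (c *: w) = 0, P *m (c *: w) = c *: w &
    v^T *m (c *: w) = 0].
  by rewrite -!scalemxAr Q1w Pw vw !scaler0.
have {Q2v} [k Q2v] : exists k, Q2 *m v = k *: (c *: w) + mu *: v.
  exists c^-1; rewrite scalerA mulVf ?scale1r //.
  by apply: contra_neq (unit_cV_neq0 cE) => ->; rewrite scale0r.
have {Q2w} [k1 [k2 Q2w]] : exists k1 k2,
    Q2 *m (c *: w) = k1 *: (c *: w) + k2 *: v.
  exists (1 - mu), (c * ((1 - mu) * mu)).
  by rewrite -scalemxAr Q2w !scalerDr !scalerA (mulrC c (1 - mu)) mulrA (mulrC c).
move: (c *: w) cE Q1w Pw vw Q2v Q2w => {w}w ww Q1w Pw vw Q2v Q2w.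
have wv : w^T *m v = 0 by rewrite -[v]trmxK -trmx_mul vw trmx0.
have [W WE] := gram2 v w; exists W; rewrite /= WE.
have Mv : (v *m v^T + w *m w^T) *m v = v.
  by rewrite mulmxDl -!mulmxA v1 wv mulmx1 mulmx0 addr0.
have Mw : (v *m v^T + w *m w^T) *m w = w.
  by rewrite mulmxDl -!mulmxA ww vw mulmx1 mulmx0 add0r.
split.
- apply: contra_eq_neq Mv => ->; rewrite mul0mx eq_sym.
  exact: unit_cV_neq0.
- by rewrite mulmxDr !mulmxA Mv Mw.
- by rewrite mulmxDr !mulmxA Pv Pw.
- rewrite -mulmxA [Q1 *m _]mulmxDr !(mulmxA Q1) Q1v Q1w mul0mx addr0.
  by rewrite mulmxA Mv.
- rewrite -mulmxA [Q2 *m _]mulmxDr !(mulmxA Q2) Q2v Q2w.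
  rewrite mulmxDr [_ *m (_ *m v^T)]mulmxA [_ *m (_ *m w^T)]mulmxA.
  by rewrite ![_ *m (_ *: _ + _)]mulmxDr -!scalemxAr Mv Mw.
Qed.

(** Induction on the rank of a projection [P] commuting with both, the part still to be split. An
    invariant subspace of dimension at most 2, with projection [M], is removed; since [Q1] and [Q2]
    are symmetric they commute with [M], so [P - M] satisfies the same hypotheses. *)
Lemma two_proj_dec (R : realType) n (Q1 Q2 : 'M[R]_n) :
  is_proj Q1 -> is_proj Q2 -> proj_dec 1%:M Q1 Q2.
Proof.
move=> P1 P2.
suff dec (P : 'M_n) : is_proj P -> P *m Q1 = Q1 *m P -> P *m Q2 = Q2 *m P ->
    proj_dec P (P *m Q1) (P *m Q2).
  have := dec 1%:M; rewrite !mul1mx !mulmx1; apply=> //.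
  by split; rewrite ?trmx1 ?mul1mx.
have [N] := ubnP (\rank P); elim: N P => // N IHN P; rewrite ltnS => rP.
move=> [sP iP] c1 c2; have [->|P0] := eqVneq P 0.
  by rewrite !mul0mx; exact: proj_dec0.
have [W] := two_proj_invariant P1 P2 (conj sP iP) c1 c2 P0.
set M := W^T *m W => /= -[M0 iM PM M1 M2].
have sM : M^T = M by rewrite /M trmx_mul trmxK.
have MP : M *m P = M by rewrite -sM -{1}sP -trmx_mul PM.
have comm (Q : 'M[R]_n) : is_proj Q -> M *m Q *m M = Q *m M -> M *m Q = Q *m M.
  move=> [sQ _] MQ; have /(congr1 trmx) := MQ.
  by rewrite (trmx_mul (M *m Q)) (trmx_mul M) (trmx_mul Q) sM sQ mulmxA MQ.
have WM : W *m M = W by exact: gram_proj_id.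
have MWT : M *m W^T = W^T by rewrite -{1}sM -trmx_mul WM.
(* [W *m W^T] may have rank 1, so [W^T] need not be an isometry; the compression is still idempotent
   because [M] commutes with [Q] and fixes [W^T]. *)
have projW (Q : 'M[R]_n) : is_proj Q -> M *m Q = Q *m M ->
    is_proj (W *m Q *m W^T).
  move=> [sQ iQ] MQ; split; first by rewrite !trmx_mul trmxK sQ mulmxA.
  rewrite -(mulmxA (W *m Q)) !(mulmxA W^T) -/M MQ.
  by rewrite -(mulmxA Q M) MWT mulmxA -(mulmxA W) iQ.
have decM : proj_dec M (M *m Q1) (M *m Q2).
  have := proj_dec1 W (projW _ P1 (comm _ P1 M1)) (projW _ P2 (comm _ P2 M2)).
  rewrite !(mulmxA W^T) -/M -!(mulmxA _ W^T W) -/M.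
  by rewrite !(comm _ P1 M1, comm _ P2 M2) -!(mulmxA _ M M) iM.
have decN : proj_dec (P - M) ((P - M) *m Q1) ((P - M) *m Q2).
  apply: IHN.
  (* Equal ranks would give [P = D *m (P - M)], hence [P *m M = 0], whereas [P *m M = M] is
     nonzero. *)
  - apply: leq_trans rP; rewrite ltn_neqAle; apply/andP; split; last first.
      by apply: mxrankS; apply/submxP; exists (1%:M - M); rewrite mulmxBl mul1mx MP.
    apply: contraNneq M0 => rPM.
    have sPM : (P - M <= P)%MS.
      by apply/submxP; exists (1%:M - M); rewrite mulmxBl mul1mx MP.
    have /andP[_ /submxP[D PD]] : (P - M == P)%MS.
      by rewrite -(mxrank_leqif_eq sPM).2 rPM.
    by rewrite -PM {1}PD -(mulmxA D) mulmxBl PM iM subrr mulmx0.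
  - split; first by rewrite linearB /= sP sM.
    by rewrite mulmxBl !mulmxBr iP PM MP iM subrr subr0.
  - by rewrite mulmxBl mulmxBr c1 (comm _ P1 M1).
  - by rewrite mulmxBl mulmxBr c2 (comm _ P2 M2).
by have := proj_decD decM decN; rewrite -!mulmxDl addrC subrK.
Qed.

(** [A] is reduced to projections while [B] stays fixed, then [B] while the projection stays fixed.
    The fixed entries are rewritten by [avg] as averages of themselves, so that the weighted
    decompositions can be added. *)
Lemma contraction_pair_dec (R : realType) n (A B : 'M[R]_n) :
  psdmx A -> psdmx (1%:M - A) -> psdmx B -> psdmx (1%:M - B) ->
  proj_dec 1%:M A B.
Proof.
move=> A0 A1 B0 B1.
have avg t (X : 'M[R]_n) : (1 - t) *: X + t *: X = X.
  by rewrite -scalerDl subrK scale1r.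
apply: (contraction_ind (G := fun A => proj_dec 1%:M A B)) A0 A1.
  move=> t C D /andP[t0 t1] dC dD; rewrite -(avg t 1%:M) -(avg t B).
  by apply: proj_decD; apply: proj_decZ; rewrite ?subr_ge0.
move=> Q sQ iQ.
apply: (contraction_ind (G := fun B => proj_dec 1%:M Q B)) B0 B1.
  move=> t C D /andP[t0 t1] dC dD; rewrite -(avg t 1%:M) -(avg t Q).
  by apply: proj_decD; apply: proj_decZ; rewrite ?subr_ge0.
by move=> Q' sQ' iQ'; exact: two_proj_dec.
Qed.

Lemma pdmx_pair_dec (R : realType) n (H A B : 'M[R]_n) :
  pdmx H -> psdmx A -> psdmx (H - A) -> psdmx B -> psdmx (H - B) ->
  proj_dec H A B.
Proof.
move=> /pdmx_sqrt[S -> Su] A0 A1 B0 B1.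
pose T := invmx S.
have TS (C : 'M[R]_n) : C = S^T *m (T^T *m C *m T) *m S.
  by rewrite !mulmxA -trmx_mul mulVmx // trmx1 mul1mx -mulmxA mulVmx // mulmx1.
have T1 (C : 'M[R]_n) : psdmx (S^T *m S - C) -> psdmx (1%:M - T^T *m C *m T).
  move=> /(psdmx_congr T); rewrite mulmxBr mulmxBl !mulmxA -trmx_mul.
  by rewrite mulmxV // trmx1 mul1mx mulmxV.
have := proj_dec_congr S (contraction_pair_dec (psdmx_congr T A0) (T1 _ A1)
  (psdmx_congr T B0) (T1 _ B1)).
by rewrite -!TS mulmx1.
Qed.

(** * Projective images of the free square *)

(** Homogeneous coordinates, with index 0 for the constant one: [z] is the identity for a tuple and
    0 for the off-diagonal block of a dilation. A 3 x 3 matrix then acts linearly on scalars, tuples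
    and blocks alike. *)
Definition homog (V : Type) (z : V) (X : 'I_2 -> V) (i : 'I_3) : V :=
  if unlift ord0 i is Some j then X j else z.

Lemma homog0 (V : Type) (z : V) (X : 'I_2 -> V) : homog z X ord0 = z.
Proof. by rewrite /homog unlift_none. Qed.

Lemma homogS (V : Type) (z : V) (X : 'I_2 -> V) j :
  homog z X (lift ord0 j) = X j.
Proof. by rewrite /homog liftK. Qed.

Definition lincomb (R : realType) (V : lmodType R) (M : 'M[R]_3)
    (Z : 'I_3 -> V) (i : 'I_3) : V :=
  \sum_j M i j *: Z j.

Lemma lincombE (R : realType) (V : lmodType R) (M : 'M[R]_3) (Z : 'I_3 -> V) i :
  lincomb M Z i = M i ord0 *: Z ord0 + \sum_j M i (lift ord0 j) *: Z (lift ord0 j).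
Proof. by rewrite /lincomb big_ord_recl. Qed.

Lemma eq_lincomb (R : realType) (V : lmodType R) (M : 'M[R]_3)
    (Z Z' : 'I_3 -> V) : Z =1 Z' -> lincomb M Z =1 lincomb M Z'.
Proof. by move=> ZZ i; apply: eq_bigr => j _; rewrite ZZ. Qed.

Lemma lincombM (R : realType) (V : lmodType R) (M N : 'M[R]_3)
    (Z : 'I_3 -> V) i : lincomb M (lincomb N Z) i = lincomb (M *m N) Z i.
Proof.
rewrite /lincomb; under eq_bigr do rewrite scaler_sumr.
rewrite exchange_big; apply: eq_bigr => j _; rewrite mxE scaler_suml.
by apply: eq_bigr => k _; rewrite scalerA.
Qed.

Lemma lincomb1 (R : realType) (V : lmodType R) (Z : 'I_3 -> V) i :
  lincomb 1%:M Z i = Z i.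
Proof.
rewrite /lincomb (bigD1 i) //= big1 => [|j ji].
  by rewrite mxE eqxx scale1r addr0.
by rewrite mxE eq_sym (negPf ji) scale0r.
Qed.

Lemma lincomb_mul (R : realType) m n p q (M : 'M[R]_3) (A : 'M_(m, n))
    (Z : 'I_3 -> 'M_(n, p)) (B : 'M_(p, q)) i :
  A *m lincomb M Z i *m B = lincomb M (fun j => A *m Z j *m B) i.
Proof.
rewrite /lincomb mulmx_sumr mulmx_suml; apply: eq_bigr => j _.
by rewrite -scalemxAr -scalemxAl.
Qed.

Lemma lincomb_block (R : realType) n m (M : 'M[R]_3) (P : 'I_3 -> 'M_n)
    (B : 'I_3 -> 'M_(n, m)) (C : 'I_3 -> 'M_(m, n)) (G : 'I_3 -> 'M_m) i :
  lincomb M (fun j => block_mx (P j) (B j) (C j) (G j)) i =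
  block_mx (lincomb M P i) (lincomb M B i) (lincomb M C i) (lincomb M G i).
Proof.
by rewrite /lincomb !big_ord_recl !big_ord0 !addr0 !scale_block_mx !add_block_mx.
Qed.

Lemma lincomb_tr (R : realType) m n (M : 'M[R]_3) (Z : 'I_3 -> 'M_(m, n)) i :
  (lincomb M Z i)^T = lincomb M (fun j => (Z j)^T) i.
Proof.
by rewrite /lincomb linear_sum; apply: eq_bigr => j _; rewrite linearZ.
Qed.

(* [lincomb M (1, X_0, X_1) = (H_0, H_1, H_2)]: the matrix [M] of a projective
   transformation maps the tuple to the free square [0 <= H_1, H_2 <= H_0]. *)
Definition proj_square (R : realType) (M : 'M[R]_3) n (X : mxtuple R 2 n) :=
  forall j, psdmx (lincomb M (homog 1%:M X) (lift ord0 j)) /\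
    psdmx (lincomb M (homog 1%:M X) ord0 - lincomb M (homog 1%:M X) (lift ord0 j)).

(* The first row of the inverse transformation, at the vertices of [0, 1]^2. *)
Definition pos_on_square (R : realType) (N : 'M[R]_3) :=
  let a := N ord0 ord0 in
  let b := N ord0 (lift ord0 ord0) in
  let c := N ord0 (lift ord0 (lift ord0 ord0)) in
  [/\ 0 < a, 0 < a + b, 0 < a + c & 0 < a + b + c].

Lemma form_sub (R : realType) n (A B : 'M[R]_n) (v : 'cV_n) :
  (v^T *m (A - B) *m v) 0 0 = (v^T *m A *m v) 0 0 - (v^T *m B *m v) 0 0.
Proof. by rewrite mulmxBr mulmxBl !mxE. Qed.

(** On a unit vector the form equals [a + b q1 + c q2] with [q1] and [q2] in [0, 1]. It is bounded
    below by its value [e] at the corner selected by the signs of [b] and [c]. *)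
Lemma pdmx_pos_on_square (R : realType) (N : 'M[R]_3) n (Q : mxtuple R 2 n) :
  pos_on_square N ->
  (forall j, psdmx (Q j)) -> (forall j, psdmx (1%:M - Q j)) ->
  pdmx (lincomb N (homog 1%:M Q) ord0).
Proof.
case; set a := N _ _; set b := N _ _; set c := N _ _ => a0 ab ac abc Q0 Q1.
set T := lincomb _ _ _.
have formT (v : 'cV_n) : exists e, 0 < e /\
    e * (v^T *m v) 0 0 <= (v^T *m T *m v) 0 0.
  have p0 j : 0 <= (v^T *m Q j *m v) 0 0 by have [_] := Q0 j; apply.
  have p1 j : (v^T *m Q j *m v) 0 0 <= (v^T *m v) 0 0.
    by have [_ /(_ v)] := Q1 j; rewrite form_sub mulmx1 subr_ge0.
  have -> : (v^T *m T *m v) 0 0 = a * (v^T *m v) 0 0 +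
      (b * (v^T *m Q ord0 *m v) 0 0 + c * (v^T *m Q (lift ord0 ord0) *m v) 0 0).
    rewrite lincomb_mul /lincomb !big_ord_recl big_ord0 addr0.
    by rewrite homog0 !homogS mulmx1 -/a -/b -/c mxE [in X in _ + X]mxE !mxE.
  have := (p0 ord0, p1 ord0, p0 (lift ord0 ord0), p1 (lift ord0 ord0)).
  move: ((v^T *m v) 0 0) ((v^T *m Q ord0 *m v) 0 0) => s q1.
  move: ((v^T *m Q (lift ord0 ord0) *m v) 0 0) => q2 [[[h1 h2] h3] h4].
  have [b0|b0] := leP 0 b; have [c0|c0] := leP 0 c.
  - by exists a; split=> //; nra.
  - by exists (a + c); split=> //; nra.
  - by exists (a + b); split=> //; nra.
  - by exists (a + b + c); split=> //; nra.
split; first split.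
- rewrite lincomb_tr; apply: eq_lincomb => i.
  case: (unliftP ord0 i) => [j|] ->; rewrite ?homogS ?homog0 ?trmx1 //.
  by have [->] := Q0 j.
- move=> v; have [e [e0 le]] := formT v; apply: le_trans le.
  by rewrite mulr_ge0 ?gram_ge0 // ltW.
move=> v vT0; have [e [e0]] := formT v; rewrite vT0 [leRHS]mxE pmulr_rle0 // => le0.
apply: mulTmx_eq0; rewrite [LHS]mx11_scalar.
by rewrite (_ : _ 0 0 = 0) ?raddf0 //; apply/eqP; rewrite eq_le le0 gram_ge0.
Qed.

Lemma psdmx_proj_pair (R : realType) n (Q : 'M[R]_n) :
  is_proj Q -> psdmx Q /\ psdmx (1%:M - Q).
Proof.
move=> [sQ iQ]; split; apply: psdmx_proj => //; last exact: compl_proj.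
by rewrite linearB /= trmx1 sQ.
Qed.

Lemma psdmx_bounds (R : realType) n (H A : 'M[R]_n) (v : 'cV_n) :
  psdmx A -> psdmx (H - A) -> v^T *m H *m v = 0 -> v^T *m A *m v = 0.
Proof.
move=> [_ /(_ v) A0] [_ /(_ v)]; rewrite form_sub => HA Hv.
rewrite [LHS]mx11_scalar (_ : _ 0 0 = 0) ?raddf0 //; apply/eqP.
by rewrite eq_le A0 andbT; move: HA; rewrite Hv [X in X - _]mxE sub0r oppr_ge0.
Qed.

(** If the form of [H_0] vanishes at [v], the bounds [0 <= H_j <= H_0] make those of [H_1] and [H_2]
    vanish too. The identity is a linear combination of the three through [invmx M], so
    [v^T *m v = 0]. *)
Lemma proj_square_pdmx (R : realType) (M : 'M[R]_3) n (X : mxtuple R 2 n) :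
  M \in unitmx -> proj_square M X -> pdmx (lincomb M (homog 1%:M X) ord0).
Proof.
move=> Mu MX; rewrite /proj_square in MX; set H := lincomb _ _ in MX *; split=> [|v Hv].
  by rewrite -(subrK (H (lift ord0 ord0)) (H ord0)); apply: psdmxD; have [] := MX ord0.
apply: mulTmx_eq0; have <- : v^T *m lincomb (invmx M) H ord0 *m v = v^T *m v.
  by rewrite lincombM mulVmx // lincomb1 homog0 mulmx1.
rewrite lincomb_mul lincombE Hv scaler0 add0r big1 // => j _.
by have [H0 H1] := MX j; rewrite (psdmx_bounds H0 H1 Hv) scaler0.
Qed.

(* In the coordinates [b = S^T lincomb M beta], positivity of a dilation of [Y]
   forces [b_j = Q_j b_0], so the constant coordinate, which is 0 for a
   dilation, equals [S^T S b_0]. *)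
Lemma proj_pair_arveson (R : realType) (K : mxtuple_set R 2) (M : 'M[R]_3) n
    (Q : mxtuple R 2 n) (S : 'M_n) :
  (forall m (X : mxtuple R 2 m), K m X <-> symtuple X /\ proj_square M X) ->
  M \in unitmx -> (forall j, is_proj (Q j)) -> S \in unitmx ->
  let G := lincomb (invmx M) (homog 1%:M Q) in G ord0 = S^T *m S ->
  arveson K (fun j => (invmx S)^T *m G (lift ord0 j) *m invmx S).
Proof.
move=> KE Mu Qp Su G GS; set Y := fun j => _.
have ST : S^T *m (invmx S)^T = 1%:M by rewrite -trmx_mul mulVmx ?trmx1.
have TS : (invmx S)^T *m S^T = 1%:M by rewrite -trmx_mul mulmxV ?trmx1.
(* Congruence by [invmx S] turns [G ord0] into the identity: [Y] is [G] divided by its constant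
   coordinate. *)
have hY : homog 1%:M Y =1 fun i => (invmx S)^T *m G i *m invmx S.
  move=> i; case: (unliftP ord0 i) => [j|] ->; rewrite ?homogS ?homog0 //.
  by rewrite GS !mulmxA TS mul1mx mulmxV.
have MY i : lincomb M (homog 1%:M Y) i =
    (invmx S)^T *m homog 1%:M Q i *m invmx S.
  by rewrite (eq_lincomb M hY) -lincomb_mul lincombM mulmxV // lincomb1.
have KY : K n Y.
  apply/KE; split=> [j|j].
    rewrite !trmx_mul trmxK mulmxA lincomb_tr; congr (_ *m _ *m _).
    apply: eq_lincomb => i; case: (unliftP ord0 i) => [k|] ->.
      by rewrite homogS; have [] := Qp k.
    by rewrite homog0 trmx1.
  rewrite !MY homogS homog0 -mulmxBl -mulmxBr.
  by have [Q0 Q1] := psdmx_proj_pair (Qp j); split; exact: psdmx_congr.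
split=> // m beta gamma _ _ /KE[_ Kb].
pose B := lincomb M (homog 0 beta); pose b i := S^T *m B i.
have Zb : homog 1%:M (fun j => block_mx (Y j) (beta j) (beta j)^T (gamma j)) =1
    fun i => block_mx (homog 1%:M Y i) (homog 0 beta i)
      (homog 0 beta i)^T (homog 1%:M gamma i).
  move=> i; case: (unliftP ord0 i) => [j|] ->; rewrite ?homogS ?homog0 //.
  by rewrite trmx0 -scalar_mx_block.
have bQ j : b (lift ord0 j) = Q j *m b ord0.
  have [sQ iQ] := Qp j.
  have [] := Kb j; rewrite !(eq_lincomb M Zb) !lincomb_block -!lincomb_tr -/B.
  rewrite opp_block_mx add_block_mx -linearB /= !MY homogS homog0.
  rewrite -mulmxBl -mulmxBr => P1 P2.
  (* The corner is [Q j] congruent by [invmx S], so its form vanishes on the columns of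
     [S *m (1%:M - Q j)]. For [E2] the corner comes from [1%:M - Q j], and the columns are those of
     [S *m Q j]. *)
  have E1 : (1%:M - Q j) *m b (lift ord0 j) = 0.
    have VT : (S *m (1%:M - Q j))^T = (1%:M - Q j) *m S^T.
      by rewrite trmx_mul linearB /= trmx1 sQ.
    rewrite mulmxA -VT; apply: (psdmx_block_ker P1).
    rewrite VT !mulmxA -(mulmxA _ S^T) ST mulmx1 -(mulmxA _ _ S) mulVmx // mulmx1.
    by rewrite mulmxBl mul1mx iQ subrr mul0mx.
  have E2 : Q j *m (b ord0 - b (lift ord0 j)) = 0.
    have VT : (S *m Q j)^T = Q j *m S^T by rewrite trmx_mul sQ.
    rewrite -mulmxBr mulmxA -VT; apply: (psdmx_block_ker P2).
    rewrite VT !mulmxA -(mulmxA _ S^T) ST mulmx1 -(mulmxA _ _ S) mulVmx // mulmx1.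
    by rewrite mulmxBr mulmx1 iQ subrr mul0mx.
  move: E1 E2; rewrite mulmxBl mul1mx => /subr0_eq E1.
  by rewrite mulmxBr => /subr0_eq ->.
have NB i : lincomb (invmx M) B i = homog 0 beta i.
  by rewrite lincombM mulVmx // lincomb1.
(* [G ord0 *m b ord0] is a combination of the [Q j *m b ord0 = b_j], and [invmx M] sends these back
   to [S^T] times the constant coordinate of the dilation, which is 0. *)
have b0 : b ord0 = 0.
  have : S^T *m S *m b ord0 = 0.
    rewrite -GS /G -[X in X *m _]mul1mx lincomb_mul.
    rewrite -(mulmx0 _ S^T) -[in RHS](homog0 0 beta) -NB.
    rewrite -[RHS]mulmx1 lincomb_mul; apply: eq_lincomb => i.
    rewrite mul1mx mulmx1 -/(b i); case: (unliftP ord0 i) => [j|] ->.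
      by rewrite homogS bQ.
    by rewrite homog0 mul1mx.
  move/(congr1 (mulmx (invmx (S^T *m S)))).
  by rewrite mulmx0 mulKmx // unitmx_mul unitmx_tr Su.
have B0 i : B i = 0.
  have bi : b i = 0.
    by case: (unliftP ord0 i) => [j|] -> //; rewrite bQ b0 mulmx0.
  by rewrite -[B i]mul1mx -TS -mulmxA -/(b i) bi mulmx0.
move=> j; rewrite -(homogS 0 beta j) -NB /lincomb big1 // => i _.
by rewrite B0 scaler0.
Qed.

Theorem proj_square_comat (R : realType) (K : mxtuple_set R 2) (M : 'M[R]_3) :
  (forall m (X : mxtuple R 2 m), K m X <-> symtuple X /\ proj_square M X) ->
  M \in unitmx -> pos_on_square (invmx M) ->
  forall n (X : mxtuple R 2 n), K n X -> comat (level (arveson K) 2) X.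
Proof.
move=> KE Mu Npos n X /KE[_ MX]; have Hpd := proj_square_pdmx Mu MX.
rewrite /proj_square in MX; set H := lincomb M (homog 1%:M X) in MX Hpd.
have [s [sP [H0 H1 H2]]] : proj_dec (H ord0) (H (lift ord0 ord0))
    (H (lift ord0 (lift ord0 ord0))).
  by have [A1 A2] := MX ord0; have [B1 B2] := MX (lift ord0 ord0);
    exact: pdmx_pair_dec.
pose Q (x : 'M[R]_(2, n) * ('M[R]_2 * 'M[R]_2)) : mxtuple R 2 2 :=
  fun j => if j == ord0 then x.2.1 else x.2.2.
pose G x := lincomb (invmx M) (homog 1%:M (Q x)).
have Qp x : x \in s -> forall j, is_proj (Q x j).
  by move=> /sP[P1 P2] j; rewrite /Q; case: ifP.
have [S SP] : exists S, forall x, x \in s ->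
    G x ord0 = (S x)^T *m S x /\ S x \in unitmx.
  have [x|S SP] := @choice _ 'M[R]_2
    (fun x S => x \in s -> G x ord0 = S^T *m S /\ S \in unitmx); last by exists S.
  case: (boolP (x \in s)) => xs; last by exists 0.
  suff /pdmx_sqrt[T GT Tu] : pdmx (G x ord0) by exists T.
  by apply: pdmx_pos_on_square => // j; have [] := psdmx_proj_pair (Qp x xs j).
have HE i : H i = \sum_(x <- s) x.1^T *m homog 1%:M (Q x) i *m x.1.
  case: (unliftP ord0 i) => [j|] ->; last first.
    by rewrite H0; apply: eq_bigr => x _; rewrite homog0 mulmx1.
  case: (unliftP ord0 j) => [k|] ->; rewrite ?ord1 ?H1 ?H2;
    by apply: eq_bigr => x _; rewrite homogS.
have XE i : homog 1%:M X i = \sum_(x <- s) x.1^T *m G x i *m x.1.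
  rewrite -[LHS]lincomb1 -(mulVmx Mu) -lincombM /lincomb.
  rewrite [RHS](eq_bigr (fun x => \sum_j invmx M i j *:
      (x.1^T *m homog 1%:M (Q x) j *m x.1))); last first.
    by move=> x _; rewrite lincomb_mul.
  rewrite exchange_big /=; apply: eq_bigr => j _.
  by rewrite -scaler_sumr -HE.
pose t := in_tuple s.
(* Dividing the point by [S x] is compensated by multiplying its coefficient by [S x]; the Gram
   matrices of the coefficients then sum to the constant coordinate of [X], the identity. *)
exists (size s), (fun=> 2%N),
  (fun i j => (invmx (S (tnth t i)))^T *m G (tnth t i) (lift ord0 j)
     *m invmx (S (tnth t i))),
  (fun i => S (tnth t i) *m (tnth t i).1).
split=> [i|].
  have xs : tnth t i \in s by exact: mem_tnth.
  have [GS Su] := SP _ xs; split=> //.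
  exact: (proj_pair_arveson KE Mu (Qp _ xs) Su GS).
have big_s (F : _ -> 'M[R]_n) :
    \sum_(i < size s) F (tnth t i) = \sum_(x <- s) F x.
  by rewrite [RHS]big_tnth.
split=> [|j].
  rewrite (big_s (fun x => (S x *m x.1)^T *m (S x *m x.1))).
  have := XE ord0; rewrite homog0 => ->; rewrite !big_seq.
  apply: eq_bigr => x xs; have [-> _] := SP x xs.
  by rewrite trmx_mul !mulmxA.
rewrite (big_s (fun x => (S x *m x.1)^T *m
  ((invmx (S x))^T *m G x (lift ord0 j) *m invmx (S x)) *m (S x *m x.1))).
have := XE (lift ord0 j); rewrite homogS => ->; rewrite !big_seq.
apply: eq_bigr => x xs; have [_ Su] := SP x xs.
rewrite trmx_mul !mulmxA -(mulmxA _ (S x)^T) -trmx_mul mulVmx // trmx1 mulmx1.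
by rewrite -(mulmxA _ (invmx (S x))) mulVmx // mulmx1.
Qed.

(** * Plane quadrilaterals *)

Lemma convex_hull_others (R : realType) g m (v : 'I_m.+1 -> 'rV[R]_g) i
    (t : 'I_m.+1 -> R) :
  (forall j, 0 <= t j) -> t i = 0 -> \sum_j t j = 1 ->
  convex_hull (v \o lift i) (\sum_j t j *: v j).
Proof.
move=> t0 ti t1; exists (t \o lift i); split=> [j|/=|/=]; first exact: t0.
  by rewrite -t1 (bigD1_ord i) //= ti add0r.
by rewrite (bigD1_ord i) //= ti scale0r add0r.
Qed.

Lemma mem_vertex (R : realType) g m (v : 'I_m -> 'rV[R]_g) i :
  convex_hull v (v i).
Proof.
exists (fun j => (j == i)%:R); split=> [j||]; first exact: ler0n.
  by rewrite (bigD1 i) //= eqxx big1 ?addr0 // => j /negPf ->.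
rewrite (bigD1 i) //= eqxx scale1r big1 ?addr0 // => j /negPf ->.
by rewrite scale0r.
Qed.

(** If [t i] were less than 1, solving for [v i] would express it through the other points with
    weights [t j / (1 - t i)]. *)
Lemma vertex_coef (R : realType) g m (v : 'I_m.+1 -> 'rV[R]_g) i
    (t : 'I_m.+1 -> R) :
  ~ convex_hull (v \o lift i) (v i) ->
  (forall j, 0 <= t j) -> \sum_j t j = 1 -> v i = \sum_j t j *: v j -> t i = 1.
Proof.
move=> vi t0 t1 vE; apply/eqP; apply: contra_notT vi => ti1.
have d0 : 1 - t i != 0 by rewrite subr_eq0 eq_sym.
have tile1 : t i <= 1 by rewrite -t1 (bigD1 i) //= lerDl sumr_ge0.
have sE : \sum_j (if j == i then 0 else t j / (1 - t i)) *: v j =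
    (1 - t i)^-1 *: (\sum_j t j *: v j - t i *: v i).
  rewrite (bigD1 i) //= eqxx scale0r add0r [in RHS](bigD1 i) //= addrAC subrr add0r.
  rewrite scaler_sumr; apply: eq_bigr => j /negPf ->.
  by rewrite scalerA mulrC.
have -> : v i = \sum_j (if j == i then 0 else t j / (1 - t i)) *: v j.
  by rewrite sE -vE -{2}[v i]scale1r -scalerBl scalerA mulVf // scale1r.
apply: convex_hull_others => [j||]; last 2 first.
- by rewrite eqxx.
- rewrite (bigD1 i) //= eqxx add0r.
  rewrite (eq_bigr (fun j => t j / (1 - t i))) => [|j /negPf -> //].
  rewrite -mulr_suml -[X in X / _](addKr (t i)) -(bigD1 i (P := xpredT)) //= t1.
  by rewrite addrC mulfV.
by case: ifP => // _; rewrite divr_ge0 // subr_ge0.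
Qed.

(** The averaged weight at [i] is 1 by [vertex_coef]; as neither weight exceeds 1, both equal 1. *)
Lemma vertex_extreme (R : realType) g m (v : 'I_m.+1 -> 'rV[R]_g) i
    (p q : 'rV[R]_g) :
  ~ convex_hull (v \o lift i) (v i) ->
  convex_hull v p -> convex_hull v q -> v i = 2^-1 *: (p + q) -> p = v i.
Proof.
move=> vi [t [t0 t1 pE]] [u [u0 u1 qE]] vE.
have tui : 2^-1 * (t i + u i) = 1.
  apply: (vertex_coef vi (t := fun j => 2^-1 * (t j + u j))) => [j||].
  - by rewrite mulr_ge0 ?invr_ge0 ?addr_ge0 // ler0n.
  - by rewrite -mulr_sumr big_split /= t1 u1 mulVf // pnatr_eq0.
  - rewrite {1}vE pE qE -big_split /= scaler_sumr; apply: eq_bigr => j _.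
    by rewrite -scalerDl scalerA.
have le1 (s : 'I_m.+1 -> R) : (forall j, 0 <= s j) -> \sum_j s j = 1 -> s i <= 1.
  by move=> s0 s1; rewrite -s1 (bigD1 i) //= lerDl sumr_ge0.
have ti : t i = 1 by have := le1 _ t0 t1; have := le1 _ u0 u1; lra.
have tj j : j != i -> t j = 0.
  move=> ji; move: t1; rewrite (bigD1 i) //= ti => /eqP.
  rewrite -subr_eq0 addrAC subrr add0r psumr_eq0 // => /allP/(_ j).
  by rewrite mem_index_enum ji => /(_ isT)/eqP.
rewrite pE (bigD1 i) //= ti scale1r big1 ?addr0 // => j /tj ->.
by rewrite scale0r.
Qed.

(** Here [e] collects the slacks of the constraints at a point and [g] their rates of change along a
    direction: moving by [eps] either way violates none of them. *)
Lemma common_radius (R : realType) (I : finType) (e g : I -> R) :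
  (forall k, 0 <= e k) -> (forall k, e k = 0 -> g k = 0) ->
  exists eps, 0 < eps /\ forall k, eps * `|g k| <= e k.
Proof.
move=> e0 eg.
suff [eps [ep H]] : exists eps, 0 < eps /\ forall k, k \in enum I -> eps * `|g k| <= e k.
  by exists eps; split=> // k; apply: H; rewrite mem_enum.
elim: (enum I) => [|k s [eps [ep H]]]; first by exists 1; split.
have [ek|ek] := eqVneq (e k) 0.
  exists eps; split=> // l; rewrite inE => /orP[/eqP ->|/H //].
  by rewrite ek eg // normr0 mulr0.
have ekp : 0 < e k by rewrite lt_def ek e0.
have gp : 0 < 1 + `|g k| by rewrite ltr_wpDr.
(* Adding 1 keeps the denominator positive when [g k = 0]. *)
exists (Num.min eps (e k / (1 + `|g k|))); split.
  by rewrite lt_min ep divr_gt0.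
move=> l; rewrite inE => /orP[/eqP ->|/H le].
  apply: (@le_trans _ _ (e k / (1 + `|g k|) * `|g k|)).
    by rewrite ler_wpM2r // ge_min lexx orbT.
  by rewrite -mulrA ler_piMr // ler_pdivrMl // mulr1 lerDr.
by apply: le_trans le; rewrite ler_wpM2r // ge_min lexx.
Qed.

Definition aff (R : realType) (c : 'I_2 -> R) (x : 'rV[R]_2) :=
  1 + \sum_j c j * x 0 j.

Local Notation j0 := (ord0 : 'I_2).
Local Notation j1 := (lift ord0 ord0 : 'I_2).

Lemma affE (R : realType) (c : 'I_2 -> R) x :
  aff c x = 1 + (c j0 * x 0 j0 + c j1 * x 0 j1).
Proof. by rewrite /aff !big_ord_recl big_ord0 addr0. Qed.

Lemma rV2P (R : realType) (x y : 'rV[R]_2) :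
  x 0 j0 = y 0 j0 -> x 0 j1 = y 0 j1 -> x = y.
Proof.
move=> e0 e1; apply/rowP => j; case: (unliftP ord0 j) => [k|] -> //.
by rewrite (ord1 k).
Qed.

Definition cross (R : realType) (c c' : 'I_2 -> R) := c j0 * c' j1 - c j1 * c' j0.

(** Otherwise the active constraints at [v i] have parallel gradients, so some direction leaves all
    of them unchanged. Moving a little both ways along it stays in the hull, against extremality. *)
Lemma vertex_on_two_sides (R : realType) (c : 'I_4 -> 'I_2 -> R)
    (v : 'I_4 -> 'rV[R]_2) i :
  ~ convex_hull (v \o lift i) (v i) ->
  (forall x, convex_hull v x <-> forall k, 0 <= aff (c k) x) ->
  exists k k', [/\ aff (c k) (v i) = 0, aff (c k') (v i) = 0
                 & cross (c k) (c k') != 0].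
Proof.
move=> vi S; apply: contrapT => none.
have par k k' : aff (c k) (v i) = 0 -> aff (c k') (v i) = 0 ->
    cross (c k) (c k') = 0.
  move=> k0 k'0; apply/eqP; apply: contra_notT none => kk'.
  by exists k, k'.
have [d [dn0 dP]] : exists d : 'rV[R]_2, d != 0 /\
    forall k, aff (c k) (v i) = 0 -> c k j0 * d 0 j0 + c k j1 * d 0 j1 = 0.
  case: (pickP (fun k => aff (c k) (v i) == 0)) => [k /eqP k0|nok].
    (* The gradient of an active constraint turned by a right angle; it is nonzero, since a zero
       gradient would make [aff] equal to 1. *)
    exists (\row_j if j == j0 then - c k j1 else c k j0); split.
      apply/eqP => /rowP d0; move: k0; rewrite affE.
      have := d0 j0; have := d0 j1; rewrite !mxE /= => -> /eqP.
      by rewrite oppr_eq0 => /eqP ->; rewrite !mul0r !addr0 => /eqP; rewrite oner_eq0.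
    by move=> k' k'0; have := par _ _ k0 k'0; rewrite /cross !mxE /=; lra.
  exists (\row_j 1); split.
    by apply/eqP => /rowP/(_ 0)/eqP; rewrite !mxE oner_eq0.
  by move=> k /eqP; rewrite nok.
have [eps [ep epsP]] := common_radius (proj1 (S _) (mem_vertex v i)) dP.
have affD k s : aff (c k) (v i + s *: d) =
    aff (c k) (v i) + s * (c k j0 * d 0 j0 + c k j1 * d 0 j1).
  by rewrite !affE !mxE; ring.
have mem s : `|s| = eps -> convex_hull v (v i + s *: d).
  move=> sE; apply/S => k; rewrite affD; have := epsP k; rewrite -sE -normrM.
  by rewrite ler_norml => /andP[]; lra.
have pE : v i + eps *: d = v i.
  apply: (vertex_extreme vi (q := v i + (- eps) *: d)).
  - by apply: mem; rewrite gtr0_norm.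
  - by apply: mem; rewrite normrN gtr0_norm.
  - by apply/rowP => j; rewrite !mxE; field.
move/eqP: pE; rewrite -subr_eq0 addrAC subrr add0r scaler_eq0 (negPf dn0) orbF.
by rewrite gt_eqF.
Qed.

Lemma vertex_neq (R : realType) g m (v : 'I_m.+1 -> 'rV[R]_g) i j :
  ~ convex_hull (v \o lift i) (v i) -> i != j -> v i != v j.
Proof.
move=> vi ij; apply: contra_notN vi => /eqP ->.
have <- : \sum_l (l == j)%:R *: v l = v j.
  rewrite (bigD1 j) //= eqxx scale1r big1 ?addr0 // => l /negPf ->.
  by rewrite scale0r.
apply: convex_hull_others => [l||]; first exact: ler0n.
  by rewrite (negPf ij).
by rewrite (bigD1 j) //= eqxx big1 ?addr0 // => l /negPf ->.
Qed.

Lemma sides_meet_once (R : realType) (c c' : 'I_2 -> R) (x y : 'rV[R]_2) :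
  cross c c' != 0 -> aff c x = 0 -> aff c' x = 0 -> aff c y = 0 ->
  aff c' y = 0 -> x = y.
Proof.
rewrite /cross !affE => cc x1 x2 y1 y2.
have e1 : c j0 * (x 0 j0 - y 0 j0) + c j1 * (x 0 j1 - y 0 j1) = 0 by lra.
have e2 : c' j0 * (x 0 j0 - y 0 j0) + c' j1 * (x 0 j1 - y 0 j1) = 0 by lra.
apply: rV2P; apply: (mulfI cc); apply/eqP; rewrite -subr_eq0.
  rewrite (_ : _ - _ =
    c' j1 * (c j0 * (x 0 j0 - y 0 j0) + c j1 * (x 0 j1 - y 0 j1)) -
    c j1 * (c' j0 * (x 0 j0 - y 0 j0) + c' j1 * (x 0 j1 - y 0 j1))); last by ring.
  by rewrite e1 e2 !mulr0 subrr.
rewrite (_ : _ - _ =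
  c j0 * (c' j0 * (x 0 j0 - y 0 j0) + c' j1 * (x 0 j1 - y 0 j1)) -
  c' j0 * (c j0 * (x 0 j0 - y 0 j0) + c j1 * (x 0 j1 - y 0 j1))); last by ring.
by rewrite e1 e2 !mulr0 subrr.
Qed.

(** Of three points on a line, the middle one is a convex combination of the other two. *)
Lemma side_le2_vertices (R : realType) (c : 'I_2 -> R) m
    (v : 'I_m.+1 -> 'rV[R]_2) i j l :
  (forall i, ~ convex_hull (v \o lift i) (v i)) ->
  i != j -> j != l -> i != l ->
  ~ [/\ aff c (v i) = 0, aff c (v j) = 0 & aff c (v l) = 0].
Proof.
(* [s] is a coordinate along the line [aff c = 0]; up to relabelling, [v j] is the middle point. *)
move=> vP; pose s (x : 'rV[R]_2) := c j0 * x 0 j1 - c j1 * x 0 j0.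
wlog [sij sjl] : i j l / s (v i) <= s (v j) /\ s (v j) <= s (v l).
  move=> W ij jl il [ai aj al].
  have [] : [\/ (s (v i) <= s (v j) /\ s (v j) <= s (v l)) \/
                (s (v l) <= s (v j) /\ s (v j) <= s (v i)),
                (s (v j) <= s (v i) /\ s (v i) <= s (v l)) \/
                (s (v l) <= s (v i) /\ s (v i) <= s (v j)) |
                (s (v i) <= s (v l) /\ s (v l) <= s (v j)) \/
                (s (v j) <= s (v l) /\ s (v l) <= s (v i))].
  - have [/ltW ?|?] := ltP (s (v i)) (s (v j)); have [/ltW ?|?] := ltP (s (v j)) (s (v l));
      have [/ltW ?|?] := ltP (s (v i)) (s (v l));
      solve [by apply: Or31; left | by apply: Or31; right | by apply: Or32; left
           | by apply: Or32; right | by apply: Or33; left | by apply: Or33; right].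
  - by case=> h; [apply: (W i j l) | apply: (W l j i)] => //; rewrite eq_sym.
  - by case=> h; [apply: (W j i l) | apply: (W l i j)] => //; rewrite eq_sym.
  - by case=> h; [apply: (W i l j) | apply: (W j l i)] => //; rewrite eq_sym.
move=> ij jl il [ai aj al]; apply: (vP j).
(* If the end values coincide, division by zero makes [tau] equal to 0, which is still right since
   the middle value then coincides with them. *)
pose tau := (s (v j) - s (v i)) / (s (v l) - s (v i)).
have tau0 : 0 <= tau by rewrite divr_ge0 // subr_ge0 // (le_trans sij).
have tau1 : tau <= 1.
  have [sE|sne] := eqVneq (s (v l)) (s (v i)).
    by rewrite /tau sE subrr invr0 mulr0.
  have slt : 0 < s (v l) - s (v i).
    by rewrite subr_gt0 lt_def sne (le_trans sij).
  by rewrite ler_pdivrMr // mul1r lerD2r.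
have tauE : s (v j) - s (v i) = tau * (s (v l) - s (v i)).
  have [sE|sne] := eqVneq (s (v l)) (s (v i)).
    rewrite sE subrr mulr0; apply/eqP; rewrite subr_eq0 eq_le sij andbT.
    by rewrite -sE.
  by rewrite /tau mulfVK // subr_eq0.
pose t m := if m == i then 1 - tau else if m == l then tau else 0.
have tsum (V : lmodType R) (F : 'I_m.+1 -> V) :
    \sum_m t m *: F m = (1 - tau) *: F i + tau *: F l.
  rewrite (bigD1 i) //= (bigD1 l) //=; last by rewrite eq_sym.
  rewrite /t eqxx eq_sym (negPf il) eqxx big1 ?addr0 // => k /andP[/negPf -> /negPf ->].
  by rewrite scale0r.
have -> : v j = \sum_m t m *: v m.
  rewrite tsum; have nz : c j0 ^+ 2 + c j1 ^+ 2 != 0.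
    rewrite paddr_eq0 ?sqr_ge0 // !sqrf_eq0; apply/negP => /andP[/eqP c0 /eqP c1].
    by move: ai; rewrite affE c0 c1 !mul0r !addr0 => /eqP; rewrite oner_eq0.
  have aff0 k : aff c (v k) = 0 -> c j0 * v k 0 j0 + c j1 * v k 0 j1 = -1.
    by rewrite affE; lra.
  (* The error vector [(d0, d1)] is orthogonal to the gradient of [c] and to its rotation, hence
     zero. *)
  pose d0 := v j 0 j0 - ((1 - tau) * v i 0 j0 + tau * v l 0 j0).
  pose d1 := v j 0 j1 - ((1 - tau) * v i 0 j1 + tau * v l 0 j1).
  have e1 : c j0 * d0 + c j1 * d1 = 0.
    transitivity ((c j0 * v j 0 j0 + c j1 * v j 0 j1)
      - (1 - tau) * (c j0 * v i 0 j0 + c j1 * v i 0 j1)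
      - tau * (c j0 * v l 0 j0 + c j1 * v l 0 j1)); first by rewrite /d0 /d1; ring.
    by rewrite !aff0 //; ring.
  have e2 : c j0 * d1 - c j1 * d0 = 0.
    transitivity (s (v j) - s (v i) - tau * (s (v l) - s (v i))).
      by rewrite /s /d0 /d1; ring.
    by rewrite tauE subrr.
  apply: rV2P; apply: (mulfI nz); rewrite !mxE; apply/eqP; rewrite -subr_eq0.
    rewrite -mulrBr -/d0 (_ : _ * d0 = c j0 * (c j0 * d0 + c j1 * d1) -
      c j1 * (c j0 * d1 - c j1 * d0)); last by ring.
    by rewrite e1 e2 !mulr0 subrr.
  rewrite -mulrBr -/d1 (_ : _ * d1 = c j1 * (c j0 * d0 + c j1 * d1) +
    c j0 * (c j0 * d1 - c j1 * d0)); last by ring.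
  by rewrite e1 e2 !mulr0 addr0.
apply: convex_hull_others => [k||].
- by rewrite /t; case: ifP => _; [rewrite subr_ge0|case: ifP].
- by rewrite /t eq_sym (negPf ij) (negPf jl).
- by have := tsum R^o (fun=> 1); rewrite /GRing.scale /=; under eq_bigr do rewrite mulr1;
     rewrite !mulr1 subrK.
Qed.

(** In the application the points of the graph are the four sides, and its edges are the four
    vertices, each recorded as a pair of sides through it. *)
Definition incident (T : eqType) (k : T) (e : T * T) := (k == e.1) || (k == e.2).

Definition cyclically_labelled (es : seq (nat * nat)) (p t : seq nat) :=
  all (fun j => let e := nth (0, 0)%N es (nth 0%N t j) in
      let a := nth 0%N p j in let b := nth 0%N p (j.+1 %% 4)%N in
      (e == (a, b)) || (e == (b, a))) (iota 0 4).

(* Four distinct edges on four points with all degrees at most 2 form a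
   4-cycle, by enumeration of the 6^4 quadruples of edges. *)
Lemma four_cycle_enum :
  let E := [seq (a, b) | a <- iota 0 4, b <- [seq b <- iota 0 4 | (a < b)%N]] in
  all (fun e0 => all (fun e1 => all (fun e2 => all (fun e3 =>
    let es := [:: e0; e1; e2; e3] in
    if uniq es then
      if all (fun k => (count (incident k) es <= 2)%N) (iota 0 4) then
        has (fun p => has (cyclically_labelled es p) (permutations (iota 0 4)))
          (permutations (iota 0 4))
      else true
    else true) E) E) E) E.
Proof. by vm_compute. Qed.

Lemma four_cycle (e : 'I_4 -> 'I_4 * 'I_4) :
  (forall i, (e i).1 < (e i).2)%N -> injective e ->
  (forall k i j l, i != j -> j != l -> i != l ->
    ~~ [&& incident k (e i), incident k (e j) & incident k (e l)]) ->
  exists p t : 'I_4 -> 'I_4, [/\ injective p, injective t &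
    forall j, e (t j) = (p j, p (ordS j)) \/ e (t j) = (p (ordS j), p j)].
Proof.
move=> elt einj edeg.
pose f (x : 'I_4 * 'I_4) : nat * nat := (val x.1, val x.2).
have finj : injective f.
  by move=> [a b] [a' b'] [/val_inj -> /val_inj ->].
pose o k : 'I_4 := inord k.
have oK k : (k < 4)%N -> val (o k) = k by move=> ?; rewrite /= inordK.
have fE i : f (e i) \in
    [seq (a, b) | a <- iota 0 4, b <- [seq b <- iota 0 4 | (a < b)%N]].
  apply/allpairsPdep; exists (val (e i).1), (val (e i).2).
  by rewrite mem_filter !mem_iota !add0n !ltn_ord elt.
have := four_cycle_enum => /allP/(_ _ (fE (o 0%N)))/allP/(_ _ (fE (o 1%N))).
move=> /allP/(_ _ (fE (o 2%N)))/allP/(_ _ (fE (o 3%N))); cbv zeta.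
set es := [:: _; _; _; _].
have esE k : (k < 4)%N -> nth (0, 0)%N es k = f (e (o k)).
  by case: k => [|[|[|[|]]]].
have one (i j : nat) : (i < 4)%N -> (j < 4)%N -> i != j -> o i != o j.
  by move=> i4 j4; apply: contra_neq => /(congr1 val); rewrite !oK.
have -> : uniq es.
  apply/(uniqP (0, 0)%N) => i j; rewrite !inE /= => i4 j4.
  by rewrite !esE // => /finj/einj/(congr1 val); rewrite !oK.
case: ifP => [_|/negP[]]; last first.
  apply/allP => k; rewrite mem_iota => /= k4.
  have incE i : incident k (f (e i)) = incident (o k) (e i).
    by rewrite /incident -!val_eqE /= !inordK.
  rewrite /es /= !incE.
  have := edeg (o k) (o 0%N) (o 1%N) (o 2%N); have := edeg (o k) (o 0%N) (o 1%N) (o 3%N).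
  have := edeg (o k) (o 0%N) (o 2%N) (o 3%N); have := edeg (o k) (o 1%N) (o 2%N) (o 3%N).
  rewrite !one // => /(_ isT isT isT) h1 /(_ isT isT isT) h2 /(_ isT isT isT) h3.
  move=> /(_ isT isT isT); move: h1 h2 h3.
  by do 4! case: (incident _ _).
move=> /hasP[p]; rewrite mem_permutations => pP /hasP[t].
rewrite mem_permutations => tP lab.
have lt4 (s : seq nat) j : perm_eq s (iota 0 4) -> (j < 4)%N -> (nth 0%N s j < 4)%N.
  move=> sP j4; have : nth 0%N s j \in iota 0 4.
    by rewrite -(perm_mem sP) mem_nth // (perm_size sP) size_iota.
  by rewrite mem_iota.
have labinj (s : seq nat) : perm_eq s (iota 0 4) ->
    injective (fun j : 'I_4 => o (nth 0%N s j)).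
  move=> sP i j /(congr1 val); rewrite !oK ?lt4 //.
  move/uniqP => h; apply: val_inj; apply: h; rewrite ?inE ?(perm_size sP) ?size_iota //.
  by rewrite (perm_uniq sP) iota_uniq.
exists (fun j => o (nth 0%N p j)), (fun j => o (nth 0%N t j)); split; try exact: labinj.
move=> j; have /allP/(_ (val j)) := lab; rewrite mem_iota ltn_ord => /(_ isT) /=.
rewrite esE ?lt4 //.
have pairE a b (x : 'I_4 * 'I_4) :
    (a < 4)%N -> (b < 4)%N -> f x == (a, b) -> x = (o a, o b).
  move=> a4 b4 /eqP fx; apply: finj; rewrite fx /f; congr (_, _); by rewrite oK.
have p1 : (nth 0%N p j < 4)%N by rewrite lt4.
have p2 : (nth 0%N p (j.+1 %% 4) < 4)%N by rewrite lt4 // ltn_mod.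
by case/orP => /(pairE _ _ _) -> //; [left|right].
Qed.

(** Each vertex gives a pair of crossing sides; distinct vertices give distinct pairs since two such
    sides meet once, and no side occurs three times by [side_le2_vertices]. So sides and vertices
    form a 4-cycle. *)
Lemma quad_labelling (R : realType) (c : 'I_4 -> 'I_2 -> R)
    (v : 'I_4 -> 'rV[R]_2) :
  (forall i, ~ convex_hull (v \o lift i) (v i)) ->
  (forall x, convex_hull v x <-> forall k, 0 <= aff (c k) x) ->
  exists p t : 'I_4 -> 'I_4, injective p /\ forall j,
    [/\ aff (c (p j)) (v (t j)) = 0, aff (c (p (ordS j))) (v (t j)) = 0 &
        forall k, k != j -> k != ordS j -> 0 < aff (c (p k)) (v (t j))].
Proof.
move=> vi S.
have [e eP] : exists e : 'I_4 -> 'I_4 * 'I_4, forall i,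
    [/\ ((e i).1 < (e i).2)%N, aff (c (e i).1) (v i) = 0,
        aff (c (e i).2) (v i) = 0 & cross (c (e i).1) (c (e i).2) != 0].
  have [i|e eP] := @choice 'I_4 ('I_4 * 'I_4)%type (fun i e => [/\ (e.1 < e.2)%N,
    aff (c e.1) (v i) = 0, aff (c e.2) (v i) = 0 &
    cross (c e.1) (c e.2) != 0]); last by exists e.
  have [k [k' [k0 k'0 kk']]] := vertex_on_two_sides (vi i) S.
  have [lt|gt|kE] := ltngtP k k'.
  - by exists (k, k').
  - by exists (k', k); split=> //; rewrite /cross -opprB oppr_eq0 mulrC (mulrC (c k' j0)).
  - by move: kk'; rewrite (val_inj kE) /cross mulrC subrr eqxx.
have einj : injective e.
  move=> i j eij; apply/eqP; apply/negP => /negP ij.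
  have /eqP := vertex_neq (vi i) ij; apply.
  have [_ i1 i2 i3] := eP i; have [_] := eP j; rewrite -eij => h1 h2 _.
  exact: (sides_meet_once i3).
have inc0 k i : incident k (e i) -> aff (c k) (v i) = 0.
  by have [_ i1 i2 _] := eP i; case/orP=> /eqP ->.
have [|||p [t [pinj tinj pt]]] := @four_cycle e.
- by move=> i; have [] := eP i.
- by [].
- move=> k i j l ij jl il; apply/negP => /and3P[/inc0 h1 /inc0 h2 /inc0 h3].
  exact: (side_le2_vertices vi ij jl il (And3 h1 h2 h3)).
exists p, t; split=> // j.
have z j' : aff (c (p j')) (v (t j')) = 0 /\ aff (c (p (ordS j'))) (v (t j')) = 0.
  by split; apply: inc0; rewrite /incident; case: (pt j') => -> /=; rewrite eqxx ?orbT.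
split; [exact: (z j).1|exact: (z j).2|move=> k kj kSj].
rewrite lt_def (proj1 (S _) (mem_vertex _ _)) andbT; apply/eqP => kz.
(* The side [p k] already passes through [t k] and [t (ord_pred k)], so vanishing at [t j] would
   give it a third vertex. *)
have [k1 _] := z k; have [_] := z (ord_pred k); rewrite ord_predK => k2.
apply: (@side_le2_vertices _ (c (p k)) _ v (t j) (t k) (t (ord_pred k)) vi) => //.
- by rewrite (inj_eq tinj) eq_sym.
- rewrite (inj_eq tinj); move: {kj kSj kz k1 k2} k.
  by case=> [[|[|[|[|//]]]]] ?; rewrite -val_eqE.
- by rewrite (inj_eq tinj); apply: contra_neq kSj => ->; rewrite ord_predK.
Qed.

Lemma ordS_inord4 (k : nat) :
  (k < 3)%N -> ordS (inord k : 'I_4) = inord k.+1.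
Proof.
move=> k3; apply: val_inj; rewrite /= !inordK ?modn_small //.
by rewrite ltnS ltnW.
Qed.

Lemma inord4_neq (i j : nat) :
  (i < 4)%N -> (j < 4)%N -> i != j -> (inord i : 'I_4) != inord j.
Proof.
by move=> i4 j4; apply: contra_neq => /(congr1 val); rewrite /= !inordK.
Qed.

(* [m_j] vanishes exactly at [w_j] and [w_(j-1)]; the functional
   [c0 m0 + c2 m2 - c1 m1 - c3 m3] is chosen to vanish at [w_0, w_1, w_2]. *)
Lemma opposite_sides_relation (R : realType) (m : 'I_4 -> 'I_2 -> R)
    (w : 'I_4 -> 'rV[R]_2) :
  (forall j, [/\ aff (m j) (w j) = 0, aff (m (ordS j)) (w j) = 0 &
     forall k, k != j -> k != ordS j -> 0 < aff (m k) (w j)]) ->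
  exists d : 'I_4 -> R, [/\ forall k, 0 < d k,
    d (inord 0%N) + d (inord 2%N) = d (inord 1%N) + d (inord 3%N) &
    forall i, d (inord 0%N) * m (inord 0%N) i + d (inord 2%N) * m (inord 2%N) i =
      d (inord 1%N) * m (inord 1%N) i + d (inord 3%N) * m (inord 3%N) i].
Proof.
move=> mw.
pose o k : 'I_4 := inord k.
have [z00 + p0] := mw (o 0%N); rewrite ordS_inord4 // => z10.
have [z11 + p1] := mw (o 1%N); rewrite ordS_inord4 // => z21.
have [z22 + p2] := mw (o 2%N); rewrite ordS_inord4 // => z32.
move: p0 p1 p2; rewrite !ordS_inord4 // => p0 p1 p2.
have p02 := p0 (o 2%N) (@inord4_neq 2 0 isT isT isT) (@inord4_neq 2 1 isT isT isT).
have p03 := p0 (o 3%N) (@inord4_neq 3 0 isT isT isT) (@inord4_neq 3 1 isT isT isT).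
have p10 := p1 (o 0%N) (@inord4_neq 0 1 isT isT isT) (@inord4_neq 0 2 isT isT isT).
have p13 := p1 (o 3%N) (@inord4_neq 3 1 isT isT isT) (@inord4_neq 3 2 isT isT isT).
have p20 := p2 (o 0%N) (@inord4_neq 0 2 isT isT isT) (@inord4_neq 0 3 isT isT isT).
have p21 := p2 (o 1%N) (@inord4_neq 1 2 isT isT isT) (@inord4_neq 1 3 isT isT isT).
(* With [d3 = 1], the desired relation is solved for [d2] at [w_0], for [d0] at [w_1] and for [d1]
   at [w_2]; at each of these vertices two of the terms vanish. *)
pose d2 := aff (m (o 3%N)) (w (o 0%N)) / aff (m (o 2%N)) (w (o 0%N)).
pose d0 := aff (m (o 3%N)) (w (o 1%N)) / aff (m (o 0%N)) (w (o 1%N)).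
pose d1 := d0 * aff (m (o 0%N)) (w (o 2%N)) / aff (m (o 1%N)) (w (o 2%N)).
have d2p : 0 < d2 by exact: divr_gt0.
have d0p : 0 < d0 by exact: divr_gt0.
have d1p : 0 < d1 by rewrite divr_gt0 // mulr_gt0.
pose d (k : 'I_4) := nth 0 [:: d0; d1; d2; 1] k.
have dE : (d (o 0%N) = d0) * (d (o 1%N) = d1) * (d (o 2%N) = d2) * (d (o 3%N) = 1).
  by rewrite /d /o !inordK.
exists d; rewrite -!/(o _) !dE.
pose g i := d0 * m (o 0%N) i + d2 * m (o 2%N) i - d1 * m (o 1%N) i - m (o 3%N) i.
pose gc := d0 + d2 - d1 - 1.
have gE (x : 'rV[R]_2) : gc + (g j0 * x 0 j0 + g j1 * x 0 j1) =
    d0 * aff (m (o 0%N)) x + d2 * aff (m (o 2%N)) x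
    - d1 * aff (m (o 1%N)) x - aff (m (o 3%N)) x.
  by rewrite /gc /g !affE; ring.
have g0 : gc + (g j0 * w (o 0%N) 0 j0 + g j1 * w (o 0%N) 0 j1) = 0.
  by rewrite gE z00 z10 !mulr0 subr0 add0r mulfVK ?subrr // gt_eqF.
have g1 : gc + (g j0 * w (o 1%N) 0 j0 + g j1 * w (o 1%N) 0 j1) = 0.
  by rewrite gE z11 z21 !mulr0 subr0 addr0 mulfVK ?subrr // gt_eqF.
have g2 : gc + (g j0 * w (o 2%N) 0 j0 + g j1 * w (o 2%N) 0 j1) = 0.
  by rewrite gE z22 z32 mulr0 subr0 addr0 mulfVK ?subrr // gt_eqF.
(* Twice the signed area of the triangle [w_0 w_1 w_2]. It is nonzero because its product with the
   determinant of the gradients of [m_1] and [m_2] is [m_1(w_2) m_2(w_0) > 0]; an affine functional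
   vanishing at the three points is therefore 0. *)
pose D := (w (o 1%N) 0 j0 - w (o 0%N) 0 j0) * (w (o 2%N) 0 j1 - w (o 0%N) 0 j1)
  - (w (o 1%N) 0 j1 - w (o 0%N) 0 j1) * (w (o 2%N) 0 j0 - w (o 0%N) 0 j0).
have D0 : D != 0.
  have : cross (m (o 1%N)) (m (o 2%N)) * D = 
     (aff (m (o 1%N)) (w (o 1%N)) - aff (m (o 1%N)) (w (o 0%N))) *
     (aff (m (o 2%N)) (w (o 2%N)) - aff (m (o 2%N)) (w (o 0%N))) -
     (aff (m (o 1%N)) (w (o 2%N)) - aff (m (o 1%N)) (w (o 0%N))) *
     (aff (m (o 2%N)) (w (o 1%N)) - aff (m (o 2%N)) (w (o 0%N))).
    by rewrite /cross /D !affE; ring.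
  rewrite z11 z10 z22 z21 !subr0 mul0r !sub0r mulrN opprK.
  by move=> DE; apply/eqP => D0; move: (mulr_gt0 p21 p02); rewrite -DE D0 mulr0 ltxx.
have gj0 : g j0 = 0.
  apply: (mulfI D0); rewrite mulr0.
  transitivity ((gc + (g j0 * w (o 1%N) 0 j0 + g j1 * w (o 1%N) 0 j1)
      - (gc + (g j0 * w (o 0%N) 0 j0 + g j1 * w (o 0%N) 0 j1)))
      * (w (o 2%N) 0 j1 - w (o 0%N) 0 j1)
    - (gc + (g j0 * w (o 2%N) 0 j0 + g j1 * w (o 2%N) 0 j1)
      - (gc + (g j0 * w (o 0%N) 0 j0 + g j1 * w (o 0%N) 0 j1)))
      * (w (o 1%N) 0 j1 - w (o 0%N) 0 j1)); first by rewrite /D; ring.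
  by rewrite g0 g1 g2 subrr !mul0r subrr.
have gj1 : g j1 = 0.
  apply: (mulfI D0); rewrite mulr0.
  transitivity ((gc + (g j0 * w (o 2%N) 0 j0 + g j1 * w (o 2%N) 0 j1)
      - (gc + (g j0 * w (o 0%N) 0 j0 + g j1 * w (o 0%N) 0 j1)))
      * (w (o 1%N) 0 j0 - w (o 0%N) 0 j0)
    - (gc + (g j0 * w (o 1%N) 0 j0 + g j1 * w (o 1%N) 0 j1)
      - (gc + (g j0 * w (o 0%N) 0 j0 + g j1 * w (o 0%N) 0 j1)))
      * (w (o 2%N) 0 j0 - w (o 0%N) 0 j0)); first by rewrite /D; ring.
  by rewrite g0 g1 g2 subrr !mul0r subrr.
split.
- by case=> [[|[|[|[|//]]]]] ?; rewrite /d /= ?ltr01.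
- by move: g0; rewrite gj0 gj1 !mul0r !addr0 /gc; lra.
- move=> i; have : g i = 0.
    by case: (unliftP ord0 i) => [k|] -> //; rewrite (ord1 k).
  by rewrite /g mul1r; lra.
Qed.

(* The rows are [q = d0 m0 + d2 m2 = d1 m1 + d3 m3], [d0 m0] and [d1 m1]. *)
Definition square_mx (R : realType) (d : 'I_4 -> R) (m : 'I_4 -> 'I_2 -> R) :
    'M[R]_3 :=
  let L k := homog 1 (m k) in
  \matrix_(i, j) homog
    (d (inord 0%N) * L (inord 0%N) j + d (inord 2%N) * L (inord 2%N) j)
    (fun s : 'I_2 => if s == j0 then d (inord 0%N) * L (inord 0%N) j
                     else d (inord 1%N) * L (inord 1%N) j) i.

(** The unit of [aff] becomes an argument [z], so that sums and congruences, which change the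
    identity, commute with the evaluation. *)
Definition affv (R : realType) (V : lmodType R) (c : 'I_2 -> R) (z : V)
    (X : 'I_2 -> V) := z + \sum_j c j *: X j.

Lemma affvE (R : realType) (V : lmodType R) (c : 'I_2 -> R) (z : V) X :
  affv c z X = \sum_i homog 1 c i *: homog z X i.
Proof.
rewrite big_ord_recl !homog0 scale1r; congr (_ + _).
by apply: eq_bigr => j _; rewrite !homogS.
Qed.

Lemma square_mxE (R : realType) (V : lmodType R) (d : 'I_4 -> R)
    (m : 'I_4 -> 'I_2 -> R) (z : V) (X : 'I_2 -> V) :
  [/\ lincomb (square_mx d m) (homog z X) ord0 =
        d (inord 0%N) *: affv (m (inord 0%N)) z X +
        d (inord 2%N) *: affv (m (inord 2%N)) z X,
      lincomb (square_mx d m) (homog z X) (lift ord0 j0) =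
        d (inord 0%N) *: affv (m (inord 0%N)) z X &
      lincomb (square_mx d m) (homog z X) (lift ord0 j1) =
        d (inord 1%N) *: affv (m (inord 1%N)) z X].
Proof.
rewrite !affvE !scaler_sumr -big_split /lincomb.
split; apply: eq_bigr => i _; rewrite mxE ?homog0 ?homogS /= ?eqxx ?scalerDl ?scalerA //.
Qed.

Lemma quad_proj_square (R : realType) (c : 'I_4 -> 'I_2 -> R)
    (v : 'I_4 -> 'rV[R]_2) :
  (forall i, ~ convex_hull (v \o lift i) (v i)) ->
  (forall x, convex_hull v x <-> forall k, 0 <= aff (c k) x) ->
  exists M : 'M[R]_3, [/\ M \in unitmx, pos_on_square (invmx M) &
    forall n (X : mxtuple R 2 n),
      proj_square M X <-> forall k, psdmx (affv (c k) 1%:M X)].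
Proof.
move=> vi S; have [p [t [pinj lab]]] := quad_labelling vi S.
pose m := c \o p; pose w := v \o t.
have [d [d0 dc dm]] := @opposite_sides_relation _ m w lab.
have rel (V : lmodType R) (z : V) X :
    d (inord 0%N) *: affv (m (inord 0%N)) z X +
    d (inord 2%N) *: affv (m (inord 2%N)) z X =
    d (inord 1%N) *: affv (m (inord 1%N)) z X +
    d (inord 3%N) *: affv (m (inord 3%N)) z X.
  rewrite !affvE !scaler_sumr -!big_split /=; apply: eq_bigr => i _.
  rewrite !scalerA -!scalerDl; congr (_ *: _).
  by case: (unliftP ord0 i) => [j|] ->; rewrite ?homog0 ?homogS ?mulr1.
pose M := square_mx d m; exists M.
pose h (x : 'rV[R]_2) := lincomb M (homog (1 : R^o) (x 0)).
have affvR k (x : 'rV[R]_2) : affv (m k) (1 : R^o) (x 0) = aff (m k) x by [].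
have hE x : [/\ h x ord0 = d (inord 0%N) * aff (m (inord 0%N)) x +
        d (inord 2%N) * aff (m (inord 2%N)) x,
      h x (lift ord0 j0) = d (inord 0%N) * aff (m (inord 0%N)) x &
      h x (lift ord0 j1) = d (inord 1%N) * aff (m (inord 1%N)) x].
  exact: (square_mxE d m (1 : R^o) (x 0)).
have relR x : d (inord 0%N) * aff (m (inord 0%N)) x +
    d (inord 2%N) * aff (m (inord 2%N)) x =
    d (inord 1%N) * aff (m (inord 1%N)) x +
    d (inord 3%N) * aff (m (inord 3%N)) x.
  exact: (rel _ (1 : R^o) (x 0)).
pose o k : 'I_4 := inord k.
have oS3 : ordS (o 3%N) = o 0%N by apply: val_inj; rewrite /= /o !inordK.
(* In homogeneous coordinates the vertices go to the corners (0,0), (1,0), (1,1), (0,1) of the unit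
   square, each with a positive factor [q]. *)
have h_vertex : exists q : 'I_4 -> R, [/\ forall j, 0 < q j,
    [/\ h (w (o 0%N)) ord0 = q (o 0%N), h (w (o 0%N)) (lift ord0 j0) = 0 &
        h (w (o 0%N)) (lift ord0 j1) = 0],
    [/\ h (w (o 1%N)) ord0 = q (o 1%N), h (w (o 1%N)) (lift ord0 j0) = q (o 1%N) &
        h (w (o 1%N)) (lift ord0 j1) = 0],
    [/\ h (w (o 2%N)) ord0 = q (o 2%N), h (w (o 2%N)) (lift ord0 j0) = q (o 2%N) &
        h (w (o 2%N)) (lift ord0 j1) = q (o 2%N)] &
    [/\ h (w (o 3%N)) ord0 = q (o 3%N), h (w (o 3%N)) (lift ord0 j0) = 0 &
        h (w (o 3%N)) (lift ord0 j1) = q (o 3%N)]].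
  exists (fun j => h (w j) ord0).
  have [z00 + p0] := lab (o 0%N); rewrite ordS_inord4 // => z10.
  have [z11 + p1] := lab (o 1%N); rewrite ordS_inord4 // => z21.
  have [z22 + p2] := lab (o 2%N); rewrite ordS_inord4 // => z32.
  have [z33 + p3] := lab (o 3%N); rewrite oS3 // => z03.
  move: p0 p1 p2 p3; rewrite (@ordS_inord4 0) // (@ordS_inord4 1) // (@ordS_inord4 2) //.
  rewrite oS3 => p0 p1 p2 p3.
  have p02 := p0 (o 2%N) (@inord4_neq 2 0 isT isT isT) (@inord4_neq 2 1 isT isT isT).
  have p10 := p1 (o 0%N) (@inord4_neq 0 1 isT isT isT) (@inord4_neq 0 2 isT isT isT).
  have p20 := p2 (o 0%N) (@inord4_neq 0 2 isT isT isT) (@inord4_neq 0 3 isT isT isT).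
  have p32 := p3 (o 2%N) (@inord4_neq 2 3 isT isT isT) (@inord4_neq 2 0 isT isT isT).
  split.
  - case=> [[|[|[|[|//]]]]] jP; rewrite -(inord_val (Ordinal jP)) /=.
    + by have [-> _ _] := hE (w (o 0%N)); rewrite z00 mulr0 add0r mulr_gt0.
    + by have [-> _ _] := hE (w (o 1%N)); rewrite z21 mulr0 addr0 mulr_gt0.
    + by have [-> _ _] := hE (w (o 2%N)); rewrite z22 mulr0 addr0 mulr_gt0.
    + by have [-> _ _] := hE (w (o 3%N)); rewrite z03 mulr0 add0r mulr_gt0.
  - by have [_ -> ->] := hE (w (o 0%N)); rewrite z00 z10 !mulr0.
  - by have [-> -> ->] := hE (w (o 1%N)); rewrite z11 z21 !mulr0 addr0.
  - have [-> -> ->] := hE (w (o 2%N)); have := relR (w (o 2%N)).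
    by rewrite z22 z32 !mulr0 !addr0.
  - have [-> -> ->] := hE (w (o 3%N)); have := relR (w (o 3%N)).
    by rewrite z03 z33 !mulr0 !addr0.
have {h_vertex} [q [q0 [h00 h01 h02] [h10 h11 h12] [h20 h21 h22] [h30 h31 h32]]] := h_vertex.
have Mu : M \in unitmx.
  rewrite -row_free_unit -kermx_eq0; apply/eqP/row_matrixP => i.
  rewrite row0; set u := row i (kermx M).
  have uM : u *m M = 0 by rewrite -row_mul mulmx_ker row0.
  (* A left null vector of [M] annihilates every [h x]; the values at [w_0], [w_1] and [w_3] form a
     triangular system with pivots [q]. *)
  have uh x : u 0 ord0 * h x ord0 + (u 0 (lift ord0 j0) * h x (lift ord0 j0) +
      u 0 (lift ord0 j1) * h x (lift ord0 j1)) = 0.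
    have : \sum_j u 0 j * h x j = 0.
      rewrite /h /lincomb (eq_bigr (fun j => \sum_k (u 0 j * M j k) * homog 1 (x 0) k)).
        rewrite exchange_big big1 //= => k _; rewrite -mulr_suml.
        by have /matrixP/(_ 0 k) := uM; rewrite !mxE => ->; rewrite mul0r.
      by move=> j _; rewrite mulr_sumr; apply: eq_bigr => k _; rewrite /= -mulrA.
    by rewrite !big_ord_recl big_ord0 addr0.
  have qn j : q j != 0 by rewrite gt_eqF.
  have u0 : u 0 ord0 = 0.
    have := uh (w (o 0%N)); rewrite h00 h01 h02 !mulr0 !addr0 => /eqP.
    by rewrite mulf_eq0 (negPf (qn _)) orbF => /eqP.
  have u1 : u 0 (lift ord0 j0) = 0.
    have := uh (w (o 1%N)); rewrite h10 h11 h12 u0 mul0r mulr0 add0r addr0 => /eqP.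
    by rewrite mulf_eq0 (negPf (qn _)) orbF => /eqP.
  have u2 : u 0 (lift ord0 j1) = 0.
    have := uh (w (o 3%N)); rewrite h30 h31 h32 u0 mul0r mulr0 !add0r => /eqP.
    by rewrite mulf_eq0 (negPf (qn _)) orbF => /eqP.
  apply/rowP => k; rewrite [RHS]mxE.
  case: (unliftP ord0 k) => [l|] -> //; case: (unliftP ord0 l) => [l'|] -> //.
  by rewrite (ord1 l').
split=> //.
  (* The first row of [invmx M] recovers the constant coordinate 1 from [h x], so its values at the
     corners are the inverses of the factors [q]. *)
  have Nh x : invmx M ord0 ord0 * h x ord0 +
      (invmx M ord0 (lift ord0 j0) * h x (lift ord0 j0) +
       invmx M ord0 (lift ord0 j1) * h x (lift ord0 j1)) = 1.
    have := lincombM (invmx M) M (homog (1 : R^o) (x 0)) ord0.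
    rewrite mulVmx // lincomb1 homog0 => <-.
    by rewrite [RHS]lincombE !big_ord_recl big_ord0 addr0.
  have pos j s : q j * s = 1 -> 0 < s.
    by move=> qs; rewrite -(pmulr_rgt0 _ (q0 j)) qs ltr01.
  split.
  - apply: (pos (o 0%N)); rewrite -(Nh (w (o 0%N))) h00 h01 h02; ring.
  - apply: (pos (o 1%N)); rewrite -(Nh (w (o 1%N))) h10 h11 h12; ring.
  - apply: (pos (o 3%N)); rewrite -(Nh (w (o 3%N))) h30 h31 h32; ring.
  - apply: (pos (o 2%N)); rewrite -(Nh (w (o 2%N))) h20 h21 h22; ring.
move=> n X; have [H0 H1 H2] := square_mxE d m 1%:M X.
have psdZ k : psdmx (d k *: affv (m k) 1%:M X) <-> psdmx (affv (m k) 1%:M X).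
  split=> [|?]; last by apply: psdmxZ => //; exact: ltW.
  move=> /(@psdmxZ _ _ (d k)^-1); rewrite scalerA mulVf ?gt_eqF // scale1r; apply.
  by rewrite invr_ge0 ltW.
(* The four conditions of [proj_square] are positivity of [d_k m_k]: [H_1] and [H_2] give sides 0
   and 1, the differences from [H_0] give sides 2 and 3. *)
have HE1 : lincomb M (homog 1%:M X) ord0 - lincomb M (homog 1%:M X) (lift ord0 j0)
    = d (o 2%N) *: affv (m (o 2%N)) 1%:M X by rewrite H0 H1 addrAC subrr add0r.
have HE2 : lincomb M (homog 1%:M X) ord0 - lincomb M (homog 1%:M X) (lift ord0 j1)
    = d (o 3%N) *: affv (m (o 3%N)) 1%:M X by rewrite H0 rel H2 addrAC subrr add0r.
split=> [MX k|kX j].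
  have [p' pK p'K] := injF_bij pinj.
  have mk j : psdmx (affv (m j) 1%:M X).
    apply/psdZ; have [] := MX j0; have [] := MX j1; rewrite HE1 HE2 H1 H2.
    case: j => [[|[|[|[|//]]]]] jP; rewrite -(inord_val (Ordinal jP)) //.
  by have := mk (p' k); rewrite /m /= p'K.
have mk j' : psdmx (d j' *: affv (m j') 1%:M X) by apply/psdZ; exact: kX.
case: (unliftP ord0 j) => [l|] ->; rewrite ?(ord1 l).
  by rewrite HE2 H2.
by rewrite HE1 H1.
Qed.

(** * Free quadrilaterals *)

Lemma affv_congr (R : realType) n m (c : 'I_2 -> R) (A : 'M[R]_n)
    (X : 'I_2 -> 'M_n) (V : 'M_(n, m)) :
  V^T *m affv c A X *m V = affv c (V^T *m A *m V) (fun j => V^T *m X j *m V).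
Proof.
rewrite /affv mulmxDr mulmxDl mulmx_sumr mulmx_suml; congr (_ + _).
by apply: eq_bigr => j _; rewrite -scalemxAr -scalemxAl.
Qed.

Lemma affv_sum (R : realType) (V : lmodType R) (c : 'I_2 -> R) (I : finType)
    (z : I -> V) (X : I -> 'I_2 -> V) :
  affv c (\sum_i z i) (fun j => \sum_i X i j) = \sum_i affv c (z i) (X i).
Proof.
rewrite /affv big_split /= exchange_big /=; congr (_ + _).
by apply: eq_bigr => j _; rewrite scaler_sumr.
Qed.

Lemma free_spec_diag (R : realType) d (C : mxtuple R 2 d) :
  (forall j, is_diag_mx (C j)) -> forall n (X : mxtuple R 2 n),
  free_spec C X <->
  symtuple X /\ forall k, psdmx (affv (fun j => C j k k) 1%:M X).
Proof.
move=> Cdiag n X.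
(* [E k] includes the [k]-th block of size [n]; for diagonal [C] the pencil is block diagonal with
   blocks [P k]. *)
pose E k : 'M[R]_(d * n, n) := \matrix_(i, a) (i == mxtens_index (k, a))%:R.
pose P k := affv (fun j => C j k k) 1%:M X.
have EE k l : (E k)^T *m E l = (k == l)%:R%:M.
  apply/matrixP => a b; rewrite !mxE (bigD1 (mxtens_index (k, a))) //= big1 ?addr0.
    rewrite !mxE eqxx mul1r (inj_eq (can_inj (@mxtens_indexK _ _))) xpair_eqE.
    by case: eqP => //=; rewrite ?mul0rn ?mulr1n // mul0rn.
  by move=> i /negPf ik; rewrite !mxE ik mul0r.
have CE : 1%:M + \sum_(j < 2) C j *t X j = \sum_k E k *m P k *m (E k)^T.
  apply/matrixP => i j; rewrite summxE.
  rewrite -[ i ]mxtens_unindexK -[j]mxtens_unindexK.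
  case: (mxtens_unindex i) => k a; case: (mxtens_unindex j) => l b.
  have EQ k' p (Q : 'M_(n, p)) k1 a1 b1 :
      (E k' *m Q) (mxtens_index (k1, a1)) b1 = (k1 == k')%:R * Q a1 b1.
    rewrite mxE (bigD1 a1) //= big1 ?addr0 => [|i' /negPf ia].
      by rewrite mxE (inj_eq (can_inj (@mxtens_indexK _ _))) xpair_eqE eqxx andbT.
    rewrite mxE (inj_eq (can_inj (@mxtens_indexK _ _))) xpair_eqE.
    by rewrite [a1 == _]eq_sym ia andbF mul0r.
  have EPE k' : (E k' *m P k' *m (E k')^T) (mxtens_index (k, a)) (mxtens_index (l, b))
      = (k == k')%:R * ((l == k')%:R * P k' a b).
    rewrite -mulmxA EQ; congr (_ * _).
    by rewrite -[P k' *m _]trmxK trmx_mul trmxK mxE EQ mxE.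
  rewrite (eq_bigr _ (fun k' _ => EPE k')) [RHS](bigD1 k) //=.
  rewrite [X in _ = _ + X]big1 ?addr0; last first.
    by move=> k' /negPf kk'; rewrite eq_sym kk' mul0r.
  rewrite eqxx mul1r /P /affv !mxE summxE summxE (inj_eq (can_inj (@mxtens_indexK _ _))).
  rewrite xpair_eqE; have [<-|kl] := eqVneq k l.
    rewrite /= mul1r; congr (_ + _); apply: eq_bigr => j' _.
    by rewrite tensmxE mxE.
  rewrite /= mul0r add0r big1 // => j' _.
  by rewrite tensmxE (is_diag_mxP (Cdiag j')) ?mul0r.
rewrite /free_spec /= CE; split=> -[sX psd]; split=> //.
  move=> k; have := psdmx_congr (E k) psd; rewrite mulmx_sumr mulmx_suml.
  rewrite (bigD1 k) //= big1 ?addr0.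
    by rewrite !mulmxA EE eqxx mul1mx -mulmxA EE eqxx mulmx1.
  by move=> l /negPf lk; rewrite !mulmxA EE eq_sym lk raddf0 !mul0mx.
apply: psdmx_sum => k; rewrite -{1}[E k]trmxK; exact: (psdmx_congr _ (psd k)).
Qed.

Theorem proposition4p3 (R : realType) (d : nat) (A : mxtuple R 2 d)
    (symA : symtuple A) (quadA : free_quadrilateral (free_spec A)) :
  (forall (n : nat) (X : mxtuple R 2 n),
     free_extreme (free_spec A) X -> (n <= 2)%N)
  /\ free_spec A = comat (level (arveson (free_spec A)) 2).
Proof.
case: quadA => _ [v [vi S]] [C [Cdiag AC]].
pose c k j := C j k k.
have KE n (X : mxtuple R 2 n) : free_spec A X <->
    symtuple X /\ forall k, psdmx (affv (c k) 1%:M X).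
  by rewrite AC; exact: free_spec_diag.
have hullE x : convex_hull v x <-> forall k, 0 <= aff (c k) x.
  have affM k : affv (c k) 1%:M (fun j => (x 0 j)%:M) = (aff (c k) x)%:M :> 'M_1.
    rewrite /affv /aff raddfD raddf_sum; congr (_ + _).
    by apply: eq_bigr => j _; rewrite scale_scalar_mx.
  rewrite -S /level1 /=; split=> [/KE[_ psd] k|c0].
    have [_ /(_ 1%:M)] := psd k; rewrite affM trmx1 mul1mx mulmx1.
    by rewrite mxE eqxx mulr1n.
  apply/KE; split=> [j|k]; first by rewrite tr_scalar_mx.
  rewrite affM -[X in psdmx X%:M]mulr1 -scale_scalar_mx; apply: psdmxZ => //.
  by rewrite -(mul1mx 1%:M) -{1}trmx1; exact: psdmx_gram.
have [M [Mu Npos ME]] := quad_proj_square vi hullE.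
have KM n (X : mxtuple R 2 n) : free_spec A X <-> symtuple X /\ proj_square M X.
  by split=> [/KE|] [sX]; [move/ME|move/ME => ?; apply/KE].
have hull := proj_square_comat KM Mu Npos.
split=> [n X [KX ext]|].
  have [l [k [Y [V [YK [V1 XE]]]]]] := hull n X KX.
  (* Free extremality speaks only of nonzero coefficients, so the zero terms are dropped and the
     rest reindexed. *)
  pose B := [pred i | V i != 0]; pose f (i : 'I_#|B|) := enum_val i.
  have Bsum p (F : 'I_l -> 'M[R]_p) : (forall i, V i = 0 -> F i = 0) ->
      \sum_(i < #|B|) F (f i) = \sum_i F i.
    move=> F0; rewrite [RHS](bigID B) /= [X in _ + X]big1 ?addr0.
      by symmetry; exact: big_enum_val.
    by move=> i /negPn/eqP/F0.
  have [n2|n2] := leqP n 2 => //.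
  have comb : mxconv_comb (fun i => Y (f i)) (fun i => V (f i)) X.
    split=> [|j].
      rewrite (Bsum _ (fun i => (V i)^T *m V i)) // => i ->; exact: mulmx0.
    rewrite (Bsum _ (fun i => (V i)^T *m Y i j *m V i)) // => i ->.
    exact: mulmx0.
  have := ext _ _ _ _ _ _ comb.
  have Y2 i : k i = 2%N by have [] := YK i.
  (* If every [V i] vanished, the identity of size [n > 2] would be 0. *)
  case: (pickP B) => [i Bi|B0]; last first.
    have : 1%:M = 0 :> 'M[R]_n.
      rewrite -V1 big1 // => i _; have /negbFE/eqP -> := B0 i; exact: mulmx0.
    pose i0 : 'I_n := Ordinal (ltnW (ltnW n2)).
    by move/matrixP/(_ i0 i0)/eqP; rewrite !mxE eqxx oner_eq0.
  (* Both alternatives of free extremality force [n] to be at most the size 2 of the point. *)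
  move=> /(_ _ _ (enum_rank_in Bi i)) [||[kn _]|[kn _]].
  - by move=> i'; have [_ []] := YK (f i').
  - by move=> i'; exact: (enum_valP i').
  - by move: n2; rewrite -kn Y2.
  - by move: kn; rewrite Y2 ltnNge (ltnW n2).
apply: functional_extensionality_dep => n; apply/seteqP; split=> X.
  exact: hull.
(* The reverse inclusion is matrix convexity: each functional at [X] is the sum of the congruences
   of its values at the [Y i]. *)
move=> [l [k [Y [V [YK [V1 XE]]]]]].
have YP i : symtuple (Y i) /\ forall k', psdmx (affv (c k') 1%:M (Y i)).
  by apply/KE; have [_ []] := YK i.
apply/KE; split=> [j|k'].
  rewrite XE linear_sum; apply: eq_bigr => i _; rewrite /= !trmx_mul trmxK mulmxA.
  by rewrite (proj1 (YP i)).
have -> : X = fun j => \sum_i (V i)^T *m Y i j *m V i by apply/funext.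
rewrite -V1 (eq_bigr (fun i => (V i)^T *m 1%:M *m V i)) => [|i _].
  rewrite affv_sum; apply: psdmx_sum => i; rewrite -affv_congr.
  by apply: psdmx_congr; exact: (proj2 (YP i)).
by rewrite mulmx1.
Qed.
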